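(* Let $\{n_k : k\ge 0\}$ be a sequence of positive integers, let the sets $A_s$ ($s\in\mathbb{N}$) of block endpoints be associated with it as defined in the context, and let $|A_s|$ denote the cardinality of $A_s$. Consider the restricted maximal operator $$\widetilde{\sigma}^{*,\nabla}F:=\sup_{k\in\mathbb{N}}|\sigma_{n_k}F| ,\qquad F\in H_{1/2}(G).$$ (a) If $\sup_{s\in\mathbb{N}}|A_s|<\infty$, then $\widetilde{\sigma}^{*,\nabla}$ is bounded from the martingale Hardy space $H_{1/2}(G)$ to the Lebesgue space $L_{1/2}(G)$, i.e. there is a finite constant $C$ such that $\|\widetilde{\sigma}^{*,\nabla}F\|_{1/2}\le C\|F\|_{H_{1/2}}$ for all $F\in H_{1/2}(G)$. (b) If $\sup_{s\in\mathbb{N}}|A_s|=\infty$, then there exists a martingale $F\in H_{1/2}(G)$ such that $\|\widetilde{\sigma}^{*,\nabla}F\|_{1/2}=\infty$; in particular $\widetilde{\sigma}^{*,\nabla}$ is not bounded from $H_{1/2}(G)$ to $L_{1/2}(G)$.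
   Context: Notation. $\mathbb{N}=\{0,1,2,\dots\}$. $G=\prod_{j=0}^\infty Z_2$, where $Z_2=\{0,1\}$ is the discrete cyclic group of order 2; elements are $x=(x_0,x_1,\dots)$ with $x_j\in\{0,1\}$; $\mu$ is the normalized Haar (product) measure, each coordinate being uniform on $\{0,1\}$. For $x\in G$, $I_0(x)=G$ and $I_n(x)=\{y\in G: y_0=x_0,\dots,y_{n-1}=x_{n-1}\}$. $\zeta_n$ is the $\sigma$-algebra generated by the sets $I_n(x)$, $x\in G$. Walsh system: $r_k(x)=(-1)^{x_k}$; for $n=\sum_j n_j2^j$ with binary digits $n_j\in\{0,1\}$, $w_n(x)=\prod_{k=0}^\infty r_k(x)^{n_k}$. Martingales and Hardy spaces: $F=(F_n,n\in\mathbb{N})$ denotes a martingale with respect to $(\zeta_n)_{n\in\mathbb N}$ (and the measure $\mu$); $F^*=\sup_n|F_n|$. For $0<p<\infty$, $\|f\|_p=\left(\int_G|f|^p\,d\mu\right)^{1/p}$, and $H_p(G)$ is the set of martingales with $\|F\|_{H_p}:=\|F^*\|_p<\infty$. Fourier coefficients and Fejér means: $\widehat F(k)=\lim_{n\to\infty}\int_G F_n w_k\,d\mu$ (the limit exists), $S_nF=\sum_{k=0}^{n-1}\widehat F(k)w_k$, $\sigma_nF=\frac1n\sum_{k=1}^nS_kF$ for $n\ge1$. The sets $A_s$: every positive integer $n$ has a unique representation as a sum of maximal blocks of consecutive binary ones, $$n=\sum_{i=1}^{r}\sum_{k=l_i}^{t_i}2^k,\qquad 0\le l_1\le t_1\le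 l_2-2<l_2\le t_2\le\dots\le l_r-2<l_r\le t_r .$$ Call $\{l_1,t_1,l_2,t_2,\dots,l_r,t_r\}$ the set of block endpoints of $n$. For $s\in\mathbb{N}$, let $n_{s_1}\le n_{s_2}\le\dots\le n_{s_r}$ be the members of the sequence $\{n_k\}$ lying in $[2^s,2^{s+1})$; $A_s$ is the union of the sets of block endpoints of $n_{s_1},\dots,n_{s_r}$ (empty if there are none). *)

(* Defs.v *)
From HB Require Import structures.
From mathcomp Require Import all_boot all_order all_algebra.
From mathcomp Require Import zify ring lra.
From mathcomp Require Import all_classical all_reals all_analysis.
Import Order.TTheory GRing.Theory Num.Theory.
Import numFieldNormedType.Exports.

Set Implicit Arguments.
Unset Strict Implicit.
Unset Printing Implicit Defensive.

Local Open Scope classical_set_scope.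
Local Open Scope ring_scope.

Definition cylinder (n : nat) (x : nat -> bool) : set (nat -> bool) :=
  [set y | forall j, (j < n)%N -> y j = x j].

Definition cylinders (n : nat) : set (set (nat -> bool)) := range (cylinder n).

(* The product sigma-algebra on {0,1}^nat, i.e. the Borel sets of the compact
   group G, is generated by the cylinders of all ranks. *)
Definition walsh_group := g_sigma_algebraType (\bigcup_n cylinders n).

Definition zeta (n : nat) : set (set walsh_group) := <<s cylinders n >>.

Section dyadic_analysis.
Context {R : realType}.
Implicit Types (mu : probability walsh_group R) (F : nat -> walsh_group -> R).

(* The normalized Haar measure of G is the product of the uniform
   probabilities B |-> #|B| / 2 on {0,1}, and as such is determined by its
   values on the finite-dimensional rectangles. *)
Definition is_haar mu : Prop :=
  forall (n : nat) (B : nat -> {set bool}),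
    mu [set x : walsh_group | forall j, (j < n)%N -> x j \in B j] =
    (\prod_(j < n) (#|B j|%:R / 2))%:E.

Lemma measurable_cylinder n x : measurable (cylinder n x : set walsh_group).
Proof. by apply: sub_sigma_algebra; exists n => //; exists x. Qed.

Let box (x : nat -> bool) (B : nat -> {set bool}) (m k : nat) :
    set walsh_group :=
  [set y | (forall j, (j < m)%N -> y j = x j) /\
           (forall j, (m <= j < m + k)%N -> y j \in B j)].

Lemma is_haarP mu :
  is_haar mu <-> forall n x, mu (cylinder n x) = ((2^-1) ^+ n)%:E.
Proof.
split=> [muh n x|mucyl n B].
  rewrite [X in mu X](_ : _ = [set y : walsh_group |
      forall j, (j < n)%N -> y j \in [set x j]%SET]); last first.
    apply/seteqP; split=> y yx j /yx; first by move=> ->; rewrite inE.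
    by rewrite inE => /eqP.
  rewrite muh; congr EFin; under eq_bigr do rewrite cards1 mul1r.
  by rewrite prodr_const card_ord.
have boxP k : forall m x, measurable (box x B m k) /\
    mu (box x B m k) =
      ((2^-1) ^+ m * \prod_(m <= j < m + k) (#|B j|%:R / 2))%:E.
  elim: k => [m x|k IH m x].
    have -> : box x B m 0 = cylinder m x.
      apply/seteqP; split=> [y []//|y yx]; split=> // j.
      by rewrite addn0 leqNgt; case: ltnP.
    split; first exact: measurable_cylinder.
    by rewrite mucyl addn0 big_geq// mulr1.
  pose x' b j := if j == m then b else x j.
  pose S b := box x B m k.+1 `&` [set y | y m = b].
  have S_in b : b \in B m -> S b = box (x' b) B m.+1 k.
    move=> bB; apply/seteqP; split=> y /=.
      move=> [[yx yB] ymb]; split=> j.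
        rewrite ltnS /x' leq_eqVlt; case: eqP => [->//|_ /=]; exact: yx.
      by move=> /andP[mj jk]; apply: yB; rewrite (ltnW mj) addnS -addSn.
    move=> [yx yB]; have ymb : y m = b by rewrite yx// /x' eqxx.
    split=> //; split=> j.
      by move=> jm; rewrite (yx j (ltnW jm)) /x' (ltn_eqF jm).
    rewrite leq_eqVlt => /andP[/orP[/eqP<- _|mj jk]]; first by rewrite ymb.
    by apply: yB; rewrite mj addSn -addnS.
  have S_out b : b \notin B m -> S b = set0.
    move=> bB; apply/seteqP; split=> // y [[_ yB] ymb].
    by move: (yB m); rewrite ymb (negbTE bB) leqnn addnS leq_addr => /(_ isT).
  set P := \prod_(m.+1 <= j < m.+1 + k) (#|B j|%:R / 2 : R).
  have SP b : measurable (S b) /\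
      mu (S b) = ((b \in B m)%:R * (2^-1) ^+ m.+1 * P)%:E.
    have [bB|bB] := boolP (b \in B m).
      by rewrite S_in// mul1r; exact: IH.
    by rewrite S_out// measure0 !mul0r.
  have -> : box x B m k.+1 = S true `|` S false.
    by apply/seteqP; split=> y; [case ym: (y m); [left|right]|case=> -[]].
  have [[mt et] [mf ef]] := (SP true, SP false).
  split; first exact: measurableU.
  have -> : mu (S true `|` S false) = (mu (S true) + mu (S false))%E.
    apply: measureU => //.
    by apply/seteqP; split=> // y [[_ /= yt] [_ /=]]; rewrite yt.
  rewrite et ef -EFinD; congr EFin.
  rewrite big_ltn; last by rewrite addnS ltnS leq_addr.
  rewrite addnS -addSn -/P exprS.
  have -> : #|B m| = ((true \in B m) + (false \in B m))%N.
    rewrite -sum1_card big_mkcond big_bool /=.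
    by case: (true \in _); case: (false \in _).
  rewrite natrD; ring.
have [_] := boxP n 0%N (fun=> false).
rewrite expr0 mul1r add0n big_mkord => <-; congr (mu _).
by apply/seteqP; split=> y /=; [move=> yB; split|case].
Qed.

(* Haar measure is the law of the binary digits of a uniform point of [0, 1[. *)
Let digits (u : R) : walsh_group :=
  fun j => odd (Num.truncn (2 ^+ j.+1 * u)).

Let prefix_value (x : nat -> bool) : nat -> nat :=
  fix v n := if n is m.+1 then (x m + (v m).*2)%N else 0%N.

Let truncn_half m (u : R) : 0 <= u ->
  (Num.truncn (2 ^+ m.+1 * u))./2 = Num.truncn (2 ^+ m * u).
Proof.
move=> u0; apply/esym/truncn_def.
set t := Num.truncn _.
have /andP[t1 t2] : t%:R <= 2 ^+ m.+1 * u < t.+1%:R.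
  by rewrite truncn_itv// mulr_ge0// exprn_ge0.
move: t1 t2; rewrite exprS -mulrA; set v := 2 ^+ m * u => t1 t2.
have e := odd_double_half t.
have h1 : (t./2 * 2 <= t)%N by lia.
have h2 : (t.+1 <= t./2.+1 * 2)%N by lia.
move: h1 h2; rewrite -(ler_nat R) -[(t.+1 <= _)%N](ler_nat R) !natrM => h1 h2.
apply/andP; split; lra.
Qed.

Let digitsP n (u : R) x : 0 <= u -> u < 1 ->
  cylinder n x (digits u) <-> Num.truncn (2 ^+ n * u) = prefix_value x n.
Proof.
move=> u0 u1; elim: n => [|n [IH1 IH2]].
  split=> // _; rewrite expr0 mul1r; apply: truncn_def.
  by rewrite u0 u1.
split=> [H|].
  rewrite -[LHS]odd_double_half truncn_half// IH1 /=; last first.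
    by move=> j jn; apply: H; rewrite ltnS ltnW.
  by rewrite -(H n).
move=> /= H j.
have := odd_double_half (Num.truncn (2 ^+ n.+1 * u)).
rewrite truncn_half// {2}H => E.
rewrite ltnS leq_eqVlt => /orP[/eqP ->|].
  by rewrite /digits H oddD odd_double addbF oddb.
apply: IH2; rewrite -truncn_half// H.
by rewrite -[in RHS](half_bit_double (prefix_value x n) (x n)).
Qed.

Let prefix_value_lt x n : (prefix_value x n < 2 ^ n)%N.
Proof. by elim: n => //= n IH; rewrite expnS; case: (x n); lia. Qed.

Let measurable_digits : measurable_fun setT digits.
Proof.
apply: (@measurability _ _ R walsh_group setT digits (\bigcup_n cylinders n)).
  by [].
move=> _ [_ [n _ [x _ <-]] <-]; rewrite setTI.
have -> : digits @^-1` cylinder n x =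
    \bigcap_(j < n) [set u | digits u j = x j] by [].
apply: bigcap_measurableType => // j _.
pose T k := [set u : R | (Num.truncn (2 ^+ j.+1 * u) <= k)%N].
have mT k : measurable (T k).
  have -> : T k = [set` `]-oo, (k.+1%:R / 2 ^+ j.+1)[%R].
    apply/seteqP; split=> u; rewrite /T /= in_itv /= truncn_le_nat;
    by rewrite ltr_pdivlMr ?exprn_gt0// mulrC.
  exact: measurable_itv.
have -> : [set u | digits u j = x j] =
    \bigcup_(k in [set k | odd k = x j]) (T k `\` (if k is l.+1 then T l else set0)).
  apply/seteqP; split=> [u ux|u [k /= <- []]].
    exists (Num.truncn (2 ^+ j.+1 * u)) => //; split; first by rewrite /T /=.
    case E: (Num.truncn _) => [|l]//; by rewrite /T /= E ltnn.
  rewrite /T /digits /=; case: k => [|k].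
    by rewrite leqn0 => /eqP ->.
  by move=> h1 /negP; rewrite -ltnNge => h2; congr odd; lia.
apply: bigcup_measurable => k _; apply: measurableD => //.
by case: k.
Qed.

Lemma haar_exists : exists mu, is_haar mu.
Proof.
have mI : measurable [set` `[0, 1[%R : interval R] by exact: measurable_itv.
pose leb := mrestr (@lebesgue_measure R) mI.
pose law :=
  measure_function_pushforward__canonical__measure_function_Measure leb measurable_digits.
have lawE n x : law (cylinder n x) = ((2^-1) ^+ n)%:E.
  rewrite /law /= /pushforward /leb /mrestr.
  set N := prefix_value x n.
  have n2 : (0 : R) < 2 ^+ n by rewrite exprn_gt0.
  have -> : digits @^-1` cylinder n x `&` [set` `[0, 1[%R] =
      [set` `[(N%:R / 2 ^+ n)%R, (N.+1%:R / 2 ^+ n)%R[].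
    apply/seteqP; split=> u /=.
      rewrite !in_itv /= => -[ux /andP[u0 u1]].
      move/(digitsP n x u0 u1): ux => uN.
      have := truncn_itv (mulr_ge0 (ltW n2) u0); rewrite uN.
      by rewrite ler_pdivrMr// ltr_pdivlMr// ![u * _]mulrC.
    rewrite !in_itv /= => /andP[uN Nu].
    have u0 : 0 <= u by apply: le_trans uN; rewrite divr_ge0// ltW.
    have u1 : u < 1.
      apply: lt_le_trans Nu _; rewrite ler_pdivrMr// mul1r -natrX ler_nat.
      exact: prefix_value_lt.
    split; last by rewrite u0 u1.
    apply/digitsP => //; apply: truncn_def.
    by rewrite ![_ * u]mulrC -ler_pdivrMr// -ltr_pdivlMr// uN Nu.
  rewrite lebesgue_measure_itv /= lte_fin ltr_pM2r ?invr_gt0// ltr_nat ltnSn.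
  rewrite -EFinB; congr EFin; rewrite -mulrBl -natrB// subSnn mul1r.
  by rewrite exprVn.
have law1 : law setT = 1%E.
  by rewrite -(lawE 0%N (fun=> false)); congr (law _); apply/seteqP; split.
exists (mnormalize law (dirac (point : walsh_group))); apply/is_haarP => n x.
rewrite -(lawE n x) /= /mnormalize law1 eqe oner_eq0 /=.
by rewrite invr1 mule1.
Qed.

Definition bit (n j : nat) : bool := odd (n %/ 2 ^ j).

Definition rademacher (k : nat) (x : walsh_group) : R := (-1) ^+ x k.

(* The infinite product may stop at k = n since n < 2 ^ n. *)
Definition walsh (n : nat) (x : walsh_group) : R :=
  \prod_(0 <= k < n) rademacher k x ^+ bit n k.

(* Martingales with respect to (zeta n); the last clause says that F n is the
   conditional expectation of F m given zeta n. *)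
Definition martingale mu F : Prop :=
  [/\ forall n, measurable_fun [set: g_sigma_algebraType (cylinders n)] (F n),
      forall n, mu.-integrable setT (EFin \o F n)
    & forall n m (A : set walsh_group), (n <= m)%N -> zeta n A ->
        (\int[mu]_(x in A) (F m x)%:E = \int[mu]_(x in A) (F n x)%:E)%E].

Definition maximal_function F (x : walsh_group) : \bar R :=
  ereal_sup (range (fun n => `|F n x|%:E)).

Definition hardy_norm mu (p : R) F : \bar R :=
  ('N[mu]_(p%:E)[maximal_function F])%E.

Definition hardy mu (p : R) F : Prop :=
  martingale mu F /\ (hardy_norm mu p F < +oo)%E.

Definition fourier_coef mu F (k : nat) : R :=
  lim ((\int[mu]_x (F n x * walsh k x))%R @[n --> \oo]).

Definition partial_sum mu F (n : nat) (x : walsh_group) : R :=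
  \sum_(0 <= k < n) fourier_coef mu F k * walsh k x.

Definition fejer_mean mu F (n : nat) (x : walsh_group) : R :=
  n%:R^-1 * \sum_(1 <= k < n.+1) partial_sum mu F k x.

Definition restricted_maximal mu (n_ : nat -> nat) F (x : walsh_group) : \bar R :=
  ereal_sup (range (fun k => `|fejer_mean mu F (n_ k) x|%:E)).

Definition bounded_hardy_to_lebesgue mu (p : R)
    (T : (nat -> walsh_group -> R) -> walsh_group -> \bar R) : Prop :=
  exists C : R, forall F, hardy mu p F ->
    ('N[mu]_(p%:E)[T F] <= C%:E * hardy_norm mu p F)%E.

End dyadic_analysis.

(* [bs] lists the pairs (l_i, t_i) of end positions of the maximal blocks of
   consecutive ones in the binary expansion of n; distinct blocks are separated
   by at least one zero, t_i + 2 <= l_(i+1). *)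
Definition block_decomposition (n : nat) (bs : seq (nat * nat)) : Prop :=
  [/\ n = (\sum_(b <- bs) \sum_(b.1 <= k < b.2.+1) 2 ^ k)%N,
      all (fun b => b.1 <= b.2)%N bs
    & sorted (fun b c => b.2 + 2 <= c.1)%N bs].

Definition block_endpoints (n : nat) : set nat :=
  [set e | exists2 bs, block_decomposition n bs &
           exists2 b, b \in bs & e = b.1 \/ e = b.2].

Definition endpoint_set (n_ : nat -> nat) (s : nat) : set nat :=
  \bigcup_(k in [set k | (2 ^ s <= n_ k < 2 ^ s.+1)%N]) block_endpoints (n_ k).

Definition sup_card_endpoints {R : realType} (n_ : nat -> nat) : \bar R :=
  ereal_sup (range (fun s => counting (endpoint_set n_ s))).

(* Main.v *)
(** Only finitely many coordinates matter for each [n_ k], so both parts reduce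
    to functions on [{0,1}^M] with the uniform measure.  Let [fejer_sum n]
    be [n K_n].  Reflecting the summation index, [m |-> 2^S - 1 - m], gives
    [|fejer_sum n| <= g_0 + sum_j g_j] with [j] ranging over the places where two
    consecutive binary digits of [n] differ and [g_j] the sum of [2^j K_(2^j)] and
    [2^j D_(2^j)], whose square root has bounded mean.

    When the number of digit changes occurring in each dyadic block of indices is
    bounded, this estimate shows that the square root of the restricted maximal
    function of a 1/2-atom carried by an interval [I] has integral
    [O(sup |a|^(1/2) |I|)].  A martingale is cut into such atoms by stopping it one
    step before it exceeds the levels [eps 4^k].

    Conversely, if digits [a] and [a+1] of [m] differ then
    [|fejer_sum m| >= 4^a / 2] on the interval of measure [2^-(a+2)] where
    [x_0 = ... = x_(a-1) = 0] and [x_a = x_(a+1) = 1].  These intervals are disjoint,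
    so each digit change contributes a fixed amount to the integral of the square
    root, and a lacunary series of atoms with coefficients [4^-i] has a
    restricted maximal function that is not in [L_(1/2)]. *)

Require Import Defs.
From mathcomp Require Import all_boot all_order all_algebra.
From mathcomp Require Import zify ring lra finmap.
From mathcomp Require Import all_classical all_reals all_analysis.
From mathcomp Require Import measurable_realfun.
Import Order.TTheory GRing.Theory Num.Theory.
Import numFieldNormedType.Exports.
Set Implicit Arguments.
Unset Strict Implicit.
Unset Printing Implicit Defensive.
Local Open Scope classical_set_scope.
Local Open Scope ring_scope.

Local Notation G := (nat -> bool).
Local Notation sqrt := Num.sqrt.

(** * Averaging over coordinates *)

(** Every estimate concerns the mean of a square root. Since [sqrt] is subadditive, it supplies the
    triangle inequality that the quasi-norm of L_(1/2) lacks, and a supremum may be replaced by a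
    sum. For an atom of rank N this is affordable: indices n <= 2^N do not see it, and a block [2^s,
    2^(s+1)) with s >= N carries a factor 2^-s from the division by n and a factor 2^-N from the
    measure of the interval. The square roots of these factors form a geometric series of size 2^-N,
    so all that must be controlled is the number of digit changes in one block, taken over all its
    indices together. The levels grow like 4^k for the same reason: their square roots double. In
    the converse, disjointness lets the contributions of all digit changes of one block add up
    although they come from different indices. The ranks of the atoms are picked one after another,
    so that this total exceeds whatever the earlier atoms can cancel. *)

Definition flip (j : nat) (x : G) : G := fun i => x i (+) (i == j).
Definition addg (x y : G) : G := fun i => x i (+) y i.

Lemma flipK j x : flip j (flip j x) = x.
Proof. by apply/funext => i; rewrite /flip -addbA addbb addbF. Qed.

Lemma flipC i j x : flip i (flip j x) = flip j (flip i x).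
Proof. by apply/funext => k; rewrite /flip addbAC. Qed.

Lemma addg_flip j x y : addg x (flip j y) = flip j (addg x y).
Proof. by apply/funext => k; rewrite /flip /addg addbA. Qed.

Lemma addgC x y : addg x y = addg y x.
Proof. by apply/funext => k; rewrite /addg addbC. Qed.

Section averages.
Context {R : realType}.
Implicit Types (f g h : G -> R) (s : seq nat) (x y t : G).

Definition avg (j : nat) f : G -> R := fun x => (f x + f (flip j x)) / 2.
(** For distinct entries of [s] this integrates out the listed coordinates. As a composition of
    two-point averages it gives the tower property by concatenation of lists and most identities by
    induction on [s]. *)
Definition aver s f : G -> R := foldr avg f s.
(** The pointwise form of measurability with respect to [zeta M]. *)
Definition dep (M : nat) f :=
  forall x y, (forall j, (j < M)%N -> x j = y j) -> f x = f y.

Lemma aver_cat s1 s2 f : aver (s1 ++ s2) f = aver s1 (aver s2 f).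
Proof. by rewrite /aver foldr_cat. Qed.

Lemma eq_aver s f g : f =1 g -> aver s f = aver s g.
Proof. by move=> /funext ->. Qed.

Lemma averD s f g : aver s (fun x => f x + g x) = (fun x => aver s f x + aver s g x).
Proof.
elim: s => //= j s ->; apply/funext => x; rewrite /avg; ring.
Qed.

Lemma averZ s c f : aver s (fun x => c * f x) = (fun x => c * aver s f x).
Proof. elim: s => //= j s ->; apply/funext => x; rewrite /avg; ring. Qed.

Lemma aver_cst s c : aver s (fun=> c) = (fun=> c).
Proof. by elim: s => //= j s ->; apply/funext => x; rewrite /avg; lra. Qed.

Lemma averB s f g : aver s (fun x => f x - g x) = (fun x => aver s f x - aver s g x).
Proof.
by elim: s => //= j s ->; apply/funext => x; rewrite /avg; lra.
Qed.

Lemma aver_sum s (I : Type) (r : seq I) (P : pred I) (F : I -> G -> R) :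
  aver s (fun x => \sum_(i <- r | P i) F i x) = (fun x => \sum_(i <- r | P i) aver s (F
      i) x).
Proof.
elim: r => [|i r IH].
  rewrite (eq_aver _ (g := fun=> 0)); last by move=> x; rewrite big_nil.
  by rewrite aver_cst; apply/funext => x; rewrite big_nil.
rewrite (eq_aver _ (g := fun x => (if P i then F i x else 0) +
    \sum_(i <- r | P i) F i x)); last first.
  by move=> x; rewrite big_cons; case: (P i) => //; rewrite add0r.
rewrite averD IH; apply/funext => x; rewrite big_cons.
by case: (P i) => //; rewrite aver_cst add0r.
Qed.

Lemma ler_aver s f g : (forall x, f x <= g x) -> forall x, aver s f x <= aver s g x.
Proof.
move=> fg; elim: s => //= j s IH x; rewrite /avg.
by rewrite ler_pM2r ?invr_gt0// lerD.
Qed.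

Lemma aver_ge0 s f : (forall x, 0 <= f x) -> forall x, 0 <= aver s f x.
Proof. by move=> f0 x; have := ler_aver s f0 x; rewrite aver_cst. Qed.

Lemma ler_norm_aver s f x : `|aver s f x| <= aver s (fun y => `|f y|) x.
Proof.
elim: s x => //= j s IH x; rewrite /avg normrM (ger0_norm (x := 2^-1))//.
rewrite ler_pM2r ?invr_gt0//; apply: le_trans (ler_normD _ _) _.
exact: lerD.
Qed.

Lemma averM s f h : (forall j x, j \in s -> f (flip j x) = f x) ->
  aver s (fun x => f x * h x) = (fun x => f x * aver s h x).
Proof.
elim: s => //= j s IH fj; rewrite IH; last first.
  by move=> i x si; apply: fj; rewrite inE si orbT.
apply/funext => x; rewrite /avg fj ?mem_head//; ring.
Qed.

Lemma avg_flip i j f : avg i (fun x => f (flip j x)) = fun x => avg i f (flip j x).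
Proof. by apply/funext => x; rewrite /avg flipC. Qed.

Lemma aver_flip s j f : aver s (fun x => f (flip j x)) = fun x => aver s f (flip j x).
Proof. by elim: s => //= i s ->; rewrite avg_flip. Qed.

Lemma aver_inv s f j x : j \in s -> aver s f (flip j x) = aver s f x.
Proof.
elim: s x => //= i s IH x; rewrite inE => /orP[/eqP->|js].
  by rewrite /avg flipK addrC.
by rewrite /avg flipC !IH.
Qed.

(** Averaging over coordinate [j] makes the result invariant under [flip j], while oddness makes it
    change sign. Rademacher factors are cancelled in this way. *)
Lemma aver_odd s f j x : j \in s -> (forall x, f (flip j x) = - f x) -> aver s f x = 0.
Proof.
move=> js fo.
have : aver s f (flip j x) = - aver s f x.
  have -> : aver s f (flip j x) = aver s (fun x => f (flip j x)) x by rewrite aver_flip.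
  rewrite (eq_aver _ (g := fun x => -1 * f x)) ?averZ ?mulN1r//.
  by move=> y; rewrite fo mulN1r.
by rewrite aver_inv//; lra.
Qed.

Lemma aver_addg s f x : aver s (fun t => f (addg x t)) = fun t => aver s f (addg x t).
Proof.
elim: s => //= j s ->; apply/funext => t; by rewrite /avg addg_flip.
Qed.

Lemma dep_flip M f j : dep M f -> (M <= j)%N -> forall x, f (flip j x) = f x.
Proof.
move=> fM Mj x; apply: fM => i iM; rewrite /flip (ltn_eqF (leq_trans iM Mj)).
by rewrite addbF.
Qed.

Lemma dep_leq m n f : (m <= n)%N -> dep m f -> dep n f.
Proof. by move=> mn fm x y xy; apply: fm => j jm; apply/xy/(leq_trans jm). Qed.

(** If [x] and [y] agree below [n], the pairs [x], [flip n x] and [y], [flip n y] agree up to order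
    in their first [n.+1] coordinates; when [x n] and [y n] differ, the two summands are swapped. *)
Lemma dep_avg n f : dep n.+1 f -> dep n (avg n f).
Proof.
move=> fn x y xy; rewrite /avg; congr (_ / 2).
have [xyn|xyn] := eqVneq (x n) (y n).
  congr (_ + _); apply: fn => j; rewrite ltnS leq_eqVlt => /orP[/eqP->//|jn].
  - exact: xy.
  - by rewrite /flip xyn.
  - by rewrite /flip xy.
rewrite addrC; congr (_ + _); apply: fn => j; rewrite ltnS leq_eqVlt => /orP[/eqP->|jn].
- by rewrite /flip eqxx; case: (x n) (y n) xyn => -[].
- by rewrite /flip (ltn_eqF jn) addbF xy.
- by rewrite /flip eqxx; case: (x n) (y n) xyn => -[].
- by rewrite /flip (ltn_eqF jn) addbF xy.
Qed.

(** The list increases, so [foldr] averages over the last coordinate first and each average removes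
    the top coordinate. *)
Lemma dep_cexp n m f : (n <= m)%N -> dep m f -> dep n (aver (index_iota n m) f).
Proof.
move=> /subnK <-; elim: (m - n)%N f => [|k IH] f fm.
  by rewrite add0n /index_iota subnn.
rewrite addSn /index_iota subSn ?leq_addl// -(addn1 (_ - _)) iotaD aver_cat /=.
rewrite subnKC ?leq_addl//; apply: IH; exact: dep_avg.
Qed.

Lemma aver_id n s f : dep n f -> {in s, forall j, (n <= j)%N} -> aver s f = f.
Proof.
move=> fn; elim: s => //= j s IH H; rewrite IH; last first.
  by move=> i si; apply: H; rewrite inE si orbT.
apply/funext => x; rewrite /avg (@dep_flip n) ?H ?mem_head//; lra.
Qed.

End averages.

(** * Cylinders and means of functions of finitely many coordinates *)

Definition agree (N : nat) (u x : G) : bool := all (fun j => x j == u j) (iota 0 N).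

Lemma agreeP N u x : reflect (forall j, (j < N)%N -> x j = u j) (agree N u x).
Proof.
apply: (iffP allP) => [H j jN|H j]; first by apply/eqP/H; rewrite mem_iota.
by rewrite mem_iota => /= jN; apply/eqP/H.
Qed.

Lemma agreeS N u x : agree N.+1 u x = agree N u x && (x N == u N).
Proof. by rewrite /agree -(addn1 N) iotaD all_cat /= andbT. Qed.

Lemma agree_flip N u x : agree N u (flip N x) = agree N u x.
Proof.
apply/agreeP/agreeP => H j jN; rewrite -H// /flip (ltn_eqF jN) addbF//.
Qed.

Lemma agree_leq m n u x : (m <= n)%N -> agree n u x -> agree m u x.
Proof. by move=> mn /agreeP H; apply/agreeP => j jm; apply/H/(leq_trans jm). Qed.

Definition origin : G := fun=> false.

Lemma agree_addg N u x : agree N origin (addg x u) = agree N u x.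
Proof.
apply/agreeP/agreeP => H j /H; rewrite /addg /origin; by case: (x j) (u j) => -[].
Qed.

Section means.
Context {R : realType}.
Implicit Types (f g h : G -> R) (x y t u : G).

(* On functions of the first [M] coordinates this is the conditional expectation
   given the first [n] coordinates. *)
Definition cexp n M f := aver (index_iota n M) f.
Definition mean M f : R := cexp 0 M f origin.

Lemma cexp_cat n m M f : (n <= m <= M)%N -> cexp n M f = cexp n m (cexp m M f).
Proof.
move=> /andP[nm mM]; rewrite /cexp -aver_cat; congr (aver _ f).
by rewrite /index_iota -{2}(subnKC nm) -iotaD; congr iota; lia.
Qed.

Lemma cexp_dep n m f : (n <= m)%N -> dep m f -> dep n (cexp n m f).
Proof. exact: dep_cexp. Qed.

Lemma cexp_fix n M f : dep n f -> cexp n M f = f.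
Proof. by move=> fn; apply: aver_id fn _ => // j; rewrite mem_index_iota => /andP[]. Qed.

Lemma cexp_idem n m M f : (n <= m <= M)%N -> dep M f -> cexp n M (cexp m M f) = cexp n M f.
Proof.
move=> /andP[nm mM] fM; rewrite (@cexp_cat n m) ?nm// [in RHS](@cexp_cat n m) ?nm//.
by rewrite (@cexp_fix m)//; apply: cexp_dep.
Qed.

Lemma meanE M f x : dep M f -> cexp 0 M f x = mean M f.
Proof. by move=> fM; apply: (cexp_dep (leq0n _) fM). Qed.

Lemma mean_dep m M f : (m <= M)%N -> dep m f -> mean M f = mean m f.
Proof. by move=> mM fm; rewrite /mean (@cexp_cat 0 m)// (cexp_fix _ fm). Qed.

Lemma mean_cexp n M f : (n <= M)%N -> dep M f -> mean M (cexp n M f) = mean M f.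
Proof. by move=> nM fM; rewrite /mean cexp_idem. Qed.

Lemma meanD M f g : mean M (fun x => f x + g x) = mean M f + mean M g.
Proof. by rewrite /mean /cexp averD. Qed.

Lemma meanZ M c f : mean M (fun x => c * f x) = c * mean M f.
Proof. by rewrite /mean /cexp averZ. Qed.

Lemma mean_sum M (I : Type) (r : seq I) (P : pred I) (F : I -> G -> R) :
  mean M (fun x => \sum_(i <- r | P i) F i x) = \sum_(i <- r | P i) mean M (F i).
Proof. by rewrite /mean /cexp aver_sum. Qed.

Lemma mean_cst M c : mean M (fun=> c) = c.
Proof. by rewrite /mean /cexp aver_cst. Qed.

Lemma ler_mean M f g : (forall x, f x <= g x) -> mean M f <= mean M g.
Proof. by move=> fg; apply: ler_aver. Qed.

Lemma mean_ge0 M f : (forall x, 0 <= f x) -> 0 <= mean M f.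
Proof. by move=> fg; apply: aver_ge0. Qed.

Lemma eq_mean M f g : f =1 g -> mean M f = mean M g.
Proof. by move=> /funext ->. Qed.

Lemma ler_norm_mean M f : `|mean M f| <= mean M (fun x => `|f x|).
Proof. exact: ler_norm_aver. Qed.

Lemma mean_shift M f x : dep M f -> mean M (fun t => f (addg x t)) = mean M f.
Proof. by move=> fM; rewrite /mean /cexp aver_addg; apply: meanE. Qed.

Lemma cexpM n M f h : dep n f -> cexp n M (fun x => f x * h x) = (fun x => f x * cexp n M
    h x).
Proof.
move=> fn; apply: averM => j x; rewrite mem_index_iota => /andP[nj _].
exact: (dep_flip fn nj).
Qed.

Lemma dep_agree N u : dep N (fun x => (agree N u x)%:R : R).
Proof.
move=> x y xy; congr (_%:R); congr nat_of_bool.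
by apply/agreeP/agreeP => H j jN; rewrite -H// xy.
Qed.

Lemma mean_agree N M u : (N <= M)%N -> mean M (fun x => (agree N u x)%:R : R) = 2^-1 ^+ N.
Proof.
move=> NM; rewrite (mean_dep NM); last exact: dep_agree.
elim: N NM => [|N IH] NM; first by rewrite expr0 /= /mean /=.
rewrite /mean (@cexp_cat 0 N)// ?leqnSn//.
have -> : cexp N N.+1 (fun x => (agree N.+1 u x)%:R : R) =
    fun x => 2^-1 * (agree N u x)%:R.
  apply/funext => x; rewrite /cexp /index_iota subSnn /= /avg !agreeS agree_flip.
  rewrite /flip eqxx; case: (agree N u x) => /=; last by rewrite addr0 mul0r mulr0.
  by case: (x N) (u N) => -[] /=; lra.
by have := @meanZ N 2^-1 (fun x => (agree N u x)%:R); rewrite /mean => ->;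
  rewrite -/(mean _ _) IH ?exprS// ltnW.
Qed.

Lemma mean_agreeM N M u h : (N <= M)%N -> dep M h ->
  mean M (fun x => (agree N u x)%:R * h x) = 2^-1 ^+ N * cexp N M h u.
Proof.
move=> NM hM; rewrite /mean (@cexp_cat 0 N)// cexpM; last exact: dep_agree.
rewrite (_ : (fun x => _) = fun x => cexp N M h u * (agree N u x)%:R); last first.
  apply/funext => x; rewrite mulrC; have [/agreeP H|_] := boolP (agree N u x).
    by congr (_ * _); apply: (cexp_dep NM hM).
  by rewrite !mulr0.
rewrite /cexp averZ mulrC; congr (_ * _).
by have := @mean_agree N N u (leqnn N); rewrite /mean /cexp => <-.
Qed.

(** Every point lies in a cylinder of measure [2^-1 ^+ M] on which [f] is constant. Applied to
    absolute values, this shows that a function of finitely many coordinates is bounded. *)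
Lemma mean_lb M f x : dep M f -> (forall x, 0 <= f x) -> 2^-1 ^+ M * f x <= mean M f.
Proof.
move=> fM f0; have := mean_agreeM x (leqnn M) fM; rewrite (cexp_fix _ fM) => <-.
apply: ler_mean => y; case: agree; rewrite ?mul1r// mul0r//.
Qed.

End means.

(** * Dirichlet and Fejer sums *)

Lemma bitDl s m k : (k < s)%N -> bit (2 ^ s + m) k = bit m k.
Proof.
move=> ks; rewrite /bit divnDl ?dvdn_exp2l ?(ltnW ks)// oddD.
by rewrite -expnB ?(ltnW ks)// oddX subn_eq0 leqNgt ks.
Qed.

Lemma bit_small m s k : (m < 2 ^ s)%N -> (s <= k)%N -> bit m k = false.
Proof.
move=> ms sk; rewrite /bit divn_small//; apply: leq_trans ms _.
by rewrite leq_exp2l.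
Qed.

Lemma bitDs s m : (m < 2 ^ s)%N -> bit (2 ^ s + m) s.
Proof. by move=> ms; rewrite /bit divnDl// divnn expn_gt0 /= divn_small. Qed.

Lemma bit_compl S k j : (k < 2 ^ S)%N -> (j < S)%N ->
  bit (2 ^ S - 1 - k) j = ~~ bit k j.
Proof.
elim: S k j => // S IH k j; rewrite expnS => kS jS.
have [kl|kl] := ltnP k (2 ^ S).
  have -> : (2 * 2 ^ S - 1 - k = 2 ^ S + (2 ^ S - 1 - k))%N by lia.
  move: jS; rewrite ltnS leq_eqVlt => /orP[/eqP->|jS].
    by rewrite bitDs ?(bit_small kl)//; lia.
  by rewrite bitDl// IH.
have -> : (2 * 2 ^ S - 1 - k = 2 ^ S - 1 - (k - 2 ^ S))%N by lia.
have {2}-> : (k = 2 ^ S + (k - 2 ^ S))%N by lia.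
move: jS; rewrite ltnS leq_eqVlt => /orP[/eqP->|jS].
  by rewrite bitDs ?(@bit_small _ S)//; lia.
by rewrite bitDl// IH//; lia.
Qed.

Section walsh_system.
Context {R : realType}.
Implicit Types (x y : G).

Lemma walshE s n x : (n < 2 ^ s)%N ->
  walsh n x = \prod_(0 <= k < s) rademacher k x ^+ bit n k :> R.
Proof.
have aux a b : (n < 2 ^ a)%N -> (a <= b)%N ->
    \prod_(0 <= k < b) rademacher k x ^+ bit n k =
    \prod_(0 <= k < a) rademacher k x ^+ bit n k :> R.
  move=> na ab; rewrite (@big_cat_nat _ _ _ a)//= [X in _ * X]big1_seq ?mulr1//.
  move=> i; rewrite mem_index_iota => /andP[_ /andP[ai _]].
  by rewrite (bit_small na ai) expr0.
move=> ns; rewrite /walsh; have [ln|ln] := leqP n s.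
  by rewrite -(aux n s)//; exact: ltn_expl.
by rewrite -(aux s n)//; exact: ltnW.
Qed.

Lemma walshD s m x : (m < 2 ^ s)%N -> walsh (2 ^ s + m) x = rademacher s x * walsh m x :> R.
Proof.
move=> ms; rewrite (@walshE s.+1); last by rewrite expnS; lia.
rewrite big_nat_recr//= bitDs// expr1 mulrC (walshE _ ms); congr (_ * _).
by apply: eq_big_nat => i /andP[_ si]; rewrite bitDl.
Qed.

Lemma walsh0 x : walsh 0 x = 1 :> R.
Proof. by rewrite /walsh big_geq. Qed.

Lemma rademacher_addg s x y : rademacher s (addg x y) = rademacher s x * rademacher s y
    :> R.
Proof. by rewrite /rademacher /addg signr_addb. Qed.

Lemma rademacher_sq s x : rademacher s x * rademacher s x = 1 :> R.
Proof. by rewrite /rademacher -signr_addb addbb. Qed.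

Lemma walsh_addg n x y : walsh n (addg x y) = walsh n x * walsh n y :> R.
Proof.
by rewrite /walsh -big_split/=; apply: eq_bigr => k _; rewrite -exprMn -rademacher_addg.
Qed.

Lemma norm_walsh n x : `|walsh n x| = 1 :> R.
Proof.
rewrite /walsh normr_prod big1// => k _.
by rewrite normrX normrX normrN normr1 !expr1n.
Qed.

Lemma dep_walsh s n : (n < 2 ^ s)%N -> dep s (@walsh R n).
Proof.
move=> ns x y xy; rewrite !(walshE _ ns); apply: eq_big_nat => k /andP[_ ks].
by rewrite /rademacher xy.
Qed.

(** On [S] digits, [2 ^ S - 1 - k] is the complement of [k]; the Rademacher factors of [k] occur
    twice on the right and square to 1. *)
Lemma walsh_compl S k x : (k < 2 ^ S)%N ->
  walsh (2 ^ S - 1 - k) x = walsh (2 ^ S - 1) x * walsh k x :> R.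
Proof.
move=> kS; have S0 : (0 < 2 ^ S)%N by rewrite expn_gt0.
rewrite !(@walshE S) -?big_split//=; try lia.
apply: eq_big_nat => j /andP[_ jS]; rewrite bit_compl//.
have -> : bit (2 ^ S - 1) j.
  by have := @bit_compl S 0 j S0 jS; rewrite subn0 /bit div0n => ->.
by case: bit => /=; rewrite ?expr1 ?expr0 ?mulr1 ?rademacher_sq.
Qed.

Definition dirichlet n x : R := \sum_(0 <= k < n) walsh k x.
Definition fejer_sum n x : R := \sum_(1 <= k < n.+1) dirichlet k x.

Lemma dirichlet0 x : dirichlet 0 x = 0. Proof. by rewrite /dirichlet big_geq. Qed.
Lemma dirichletS n x : dirichlet n.+1 x = dirichlet n x + walsh n x.
Proof. by rewrite /dirichlet big_nat_recr. Qed.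
Lemma fejer_sum0 x : fejer_sum 0 x = 0. Proof. by rewrite /fejer_sum big_geq. Qed.
Lemma fejer_sumS n x : fejer_sum n.+1 x = fejer_sum n x + dirichlet n.+1 x.
Proof. by rewrite /fejer_sum big_nat_recr. Qed.

Lemma dirichletD s m x : (m <= 2 ^ s)%N -> dirichlet (2 ^ s + m) x = dirichlet (2 ^ s) x
    + rademacher s x * dirichlet m x.
Proof.
elim: m => [|m IH] ms; first by rewrite addn0 dirichlet0 mulr0 addr0.
by rewrite addnS !dirichletS (IH (ltnW ms)) walshD// -addrA mulrDr.
Qed.

Lemma fejer_sumD s m x : (m <= 2 ^ s)%N ->
  fejer_sum (2 ^ s + m) x = fejer_sum (2 ^ s) x + m%:R * dirichlet (2 ^ s) x + rademacher
      s x * fejer_sum m x.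
Proof.
elim: m => [|m IH] ms; first by rewrite addn0 fejer_sum0 mulr0 mul0r !addr0.
by rewrite addnS !fejer_sumS (IH (ltnW ms)) -addnS dirichletD// -natr1; ring.
Qed.

(** Paley's formula: each doubling multiplies the kernel by [1 + rademacher s x], which is 2 or 0
    according to the digit [x s]. *)
Lemma dirichlet_pow2 s x : dirichlet (2 ^ s) x = 2 ^+ s * (agree s origin x)%:R.
Proof.
elim: s => [|s IH]; first by rewrite expn0 dirichletS dirichlet0 walsh0 add0r /agree /=
    mulr1.
rewrite expnS mul2n -addnn dirichletD// IH agreeS exprS /rademacher.
by case: agree; case: (x s) => /=; rewrite ?expr1 ?expr0; lra.
Qed.

(** This is [fejer_sumD] at [m = 2 ^ s] with Paley's formula inserted. Since [1 + rademacher s x] is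
    0 or 2, it gives positivity and all later integrals of these kernels by induction. *)
Lemma fejer_sum_pow2S s x : fejer_sum (2 ^ s.+1) x = (1 + rademacher s x) * fejer_sum (2
    ^ s) x + 4 ^+ s * (agree s origin x)%:R.
Proof.
rewrite expnS mul2n -addnn fejer_sumD// dirichlet_pow2 natrX mulrA -exprMn.
rewrite (_ : 2 * 2 = 4 :> R); last by ring.
ring.
Qed.

Lemma fejer_sum_pow2_ge0 s x : 0 <= fejer_sum (2 ^ s) x.
Proof.
elim: s => [|s IH]; first by rewrite expn0 fejer_sumS fejer_sum0 add0r dirichletS
    dirichlet0 add0r walsh0.
rewrite fejer_sum_pow2S addr_ge0 ?mulr_ge0 ?exprn_ge0//.
by rewrite /rademacher; case: (x s); rewrite ?expr1 ?expr0; lra.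
Qed.

(** The missing terms have indices [2 ^ S - 1 - k] with [k < q], and [walsh_compl] extracts a common
    factor from them. *)
Lemma dirichlet_refl S q x : (q <= 2 ^ S)%N ->
  dirichlet (2 ^ S - q) x = dirichlet (2 ^ S) x - walsh (2 ^ S - 1) x * dirichlet q x.
Proof.
elim: q => [|q IH] qS; first by rewrite subn0 dirichlet0 mulr0 subr0.
have := dirichletS (2 ^ S - q.+1) x; rewrite (_ : (_ - _).+1 = 2 ^ S - q)%N; last by lia.
rewrite (IH (ltnW qS)) dirichletS (_ : (2 ^ S - q.+1 = 2 ^ S - 1 - q)%N); last by lia.
by rewrite walsh_compl// => H; lra.
Qed.

(** The removed terms are the kernels of index [2 ^ S - i] for [0 <= i < q]; reflecting each leaves
    the sum of [dirichlet i] over [i < q], which is [fejer_sum q.-1] because [dirichlet 0]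
    vanishes. *)
Lemma fejer_sum_refl S q x : (0 < q <= 2 ^ S)%N ->
  fejer_sum (2 ^ S - q) x = fejer_sum (2 ^ S) x - q%:R * dirichlet (2 ^ S) x + walsh (2 ^
      S - 1) x * fejer_sum q.-1 x.
Proof.
case: q => // q /= ; elim: q => [|q IH] qS.
  have := fejer_sumS (2 ^ S - 1) x; rewrite (_ : (_ - _).+1 = 2 ^ S)%N; last by lia.
  by rewrite fejer_sum0 => H; lra.
have := fejer_sumS (2 ^ S - q.+2) x; rewrite (_ : (_ - _).+1 = 2 ^ S - q.+1)%N; last by lia.
rewrite (IH (ltnW qS)) dirichlet_refl ?(ltnW qS)// fejer_sumS -(natr1 q.+1) => H; lra.
Qed.

Lemma dep_dirichlet s n : (n <= 2 ^ s)%N -> dep s (dirichlet n).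
Proof.
move=> ns x y xy; rewrite /dirichlet; apply: eq_big_nat => k /andP[_ kn].
exact: (dep_walsh (leq_trans kn ns) xy).
Qed.

Lemma dep_fejer_sum s n : (n <= 2 ^ s)%N -> dep s (fejer_sum n).
Proof.
move=> ns x y xy; rewrite /fejer_sum; apply: eq_big_nat => k /andP[_]; rewrite ltnS => kn.
exact: (dep_dirichlet (leq_trans kn ns) xy).
Qed.

Definition majorant j x : R := fejer_sum (2 ^ j) x + 4 ^+ j * (agree j origin x)%:R.

Lemma majorant_ge0 j x : 0 <= majorant j x.
Proof. by rewrite addr_ge0 ?fejer_sum_pow2_ge0// mulr_ge0// exprn_ge0. Qed.

Lemma dep_majorant j : dep j (majorant j).
Proof.
move=> x y xy; rewrite /majorant; congr (_ + _ * _); first exact: dep_fejer_sum (leqnn _)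
    _ _ xy.
exact: dep_agree xy.
Qed.

(** The zero above the leading digit counts, so the position just after the leading one is always a
    jump. *)
Definition jump (n j : nat) : bool := (0 < j)%N && (bit n j.-1 != bit n j).

(* If the top digit of [m] is 1, reflection replaces [m] by its binary complement,
   which has a 0 there and the same digit changes below. *)
Lemma norm_fejer_sum_le s m x : (m < 2 ^ s)%N ->
  `|fejer_sum m x| <= majorant 0 x + \sum_(1 <= j < s.+1 | jump m j) majorant j x.
Proof.
elim: s m => [|s IH] m.
  rewrite expn0 ltnS leqn0 => /eqP->; rewrite fejer_sum0 normr0 addr_ge0 ?majorant_ge0//.
  by rewrite big_geq.
move=> ms; have [ml|ml] := ltnP m (2 ^ s).
  apply: (le_trans (IH _ ml)); rewrite lerD2l big_mkcond [leRHS]big_mkcond /=.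
  rewrite [leRHS]big_nat_recr//= lerDl; case: ifP => // _; exact: majorant_ge0.
pose m' := (2 ^ s.+1 - 1 - m)%N.
have m's : (m' < 2 ^ s)%N by move: ms ml; rewrite /m' expnS; lia.
have -> : fejer_sum m x = fejer_sum (2 ^ s.+1) x - m'.+1%:R * dirichlet (2 ^ s.+1) x
    + walsh (2 ^ s.+1 - 1) x * fejer_sum m' x.
  rewrite -(@fejer_sum_refl s.+1 m'.+1); last by rewrite expnS; lia.
  by congr fejer_sum; rewrite /m'; lia.
apply: le_trans (ler_normD _ _) _; rewrite normrM norm_walsh mul1r.
(* Since [m'.+1 <= 2 ^ s.+1], the Dirichlet term is at most [4 ^+ s.+1] on the cylinder, the second
   summand of [majorant s.+1]. *)
have h1 : `|fejer_sum (2 ^ s.+1) x - m'.+1%:R * dirichlet (2 ^ s.+1) x| <= majorant s.+1 x.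
  apply: le_trans (ler_normB _ _) _; rewrite (ger0_norm (fejer_sum_pow2_ge0 _ _)) lerD2l.
  rewrite dirichlet_pow2 ger0_norm; last by rewrite mulr_ge0// mulr_ge0// exprn_ge0.
  rewrite mulrA ler_wpM2r//.
  have -> : 4 = 2 * 2 :> R by ring.
  rewrite exprMn ler_wpM2r ?exprn_ge0//.
  by rewrite -natrX ler_nat expnS; lia.
apply: le_trans (lerD h1 (IH _ m's)) _.
rewrite [X in _ + (_ + X)]big_mkcond [leRHS]addrC [in leRHS]big_mkcond /=.
rewrite [in leRHS]big_nat_recr//=.
(* The leading one of [m] is at position [s], so [s.+1] is a jump and accounts for the majorant just
   produced. *)
have -> : jump m s.+1.
  rewrite /jump /= (@bit_small m s.+1 s.+1)//.
  have -> : (m = 2 ^ s + (m - 2 ^ s))%N by lia.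
  by rewrite bitDs//; move: ms; rewrite expnS; lia.
rewrite addrA [leLHS]addrC addrAC -addrA lerD// ?(addrC (majorant 0 x))//.
rewrite le_eqVlt; apply/orP; left; apply/eqP.
apply: eq_big_nat => j /andP[j1 js].
rewrite (_ : jump m' j = jump m j)//.
rewrite /jump /m' !bit_compl//; last by lia.
by case: bit; case: bit.
Qed.

End walsh_system.

(** * Elementary estimates for square roots *)

Section square_roots.
Context {R : realType}.

Lemma sqrtD_le (a b : R) : 0 <= a -> 0 <= b -> sqrt (a + b) <= sqrt a + sqrt b.
Proof.
move=> a0 b0; have c0 : 0 <= sqrt a + sqrt b by rewrite addr_ge0 ?sqrtr_ge0.
rewrite -[leRHS]ger0_norm// -sqrtr_sqr ler_wsqrtr// sqrrD !sqr_sqrtr//.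
by rewrite addrAC lerDl mulrn_wge0// mulr_ge0 ?sqrtr_ge0.
Qed.

Lemma sqrt_sum_le (I : Type) (r : seq I) (P : pred I) (F : I -> R) :
  (forall i, 0 <= F i) ->
  sqrt (\sum_(i <- r | P i) F i) <= \sum_(i <- r | P i) sqrt (F i).
Proof.
move=> F0; elim: r => [|i r IH]; first by rewrite !big_nil sqrtr0.
rewrite !big_cons; case: ifP => // _.
apply: le_trans (sqrtD_le (F0 i) _) _; first by rewrite sumr_ge0.
by rewrite lerD2l.
Qed.

Lemma sqrt_bigmax_le (I : Type) (r : seq I) (P : pred I) (F : I -> R) (L : R) : 0 <= L ->
  (forall i, P i -> sqrt (F i) <= L) -> sqrt (\big[Num.max/0]_(i <- r | P i) F i) <= L.
Proof.
move=> L0 FL; elim/big_ind: _ => [|x y xL yL|//]; first by rewrite sqrtr0.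
by rewrite /Num.max; case: ifP.
Qed.

Lemma sqrt2_le : sqrt (2 : R) <= 3 / 2.
Proof.
rewrite -[leRHS]ger0_norm ?divr_ge0// -sqrtr_sqr ler_wsqrtr//; lra.
Qed.

Definition theta : R := sqrt 2^-1.

Lemma theta_ge0 : 0 <= theta. Proof. exact: sqrtr_ge0. Qed.

Lemma theta_sq : theta * theta = 2^-1.
Proof. by rewrite -expr2 sqr_sqrtr// invr_ge0. Qed.

Lemma theta_le : theta <= 3 / 4.
Proof.
rewrite -[leRHS]ger0_norm ?divr_ge0// -sqrtr_sqr ler_wsqrtr//; lra.
Qed.

Lemma sqrt_halfX n : sqrt (2^-1 ^+ n : R) = theta ^+ n.
Proof.
by elim: n => [|n IH]; rewrite ?expr0 ?sqrtr1// !exprS sqrtrM ?invr_ge0// IH.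
Qed.

(** The rational bound [theta <= 3 / 4] stands in for the exact ratio; 4 is [1 / (1 - 3 / 4)]. *)
Lemma sum_theta N k : \sum_(N <= s < N + k) theta ^+ s <= 4 * theta ^+ N.
Proof.
have t0 := theta_ge0; have t1 := theta_le.
suff : \sum_(N <= s < N + k) theta ^+ s <= 4 * theta ^+ N - 4 * theta ^+ (N + k).
  by move/le_trans; apply; rewrite gerBl mulr_ge0// exprn_ge0.
elim: k => [|k IH]; first by rewrite addn0 big_geq// subrr.
rewrite addnS big_nat_recr ?leq_addr//=.
have : theta * theta ^+ (N + k) <= 3 / 4 * theta ^+ (N + k).
  by rewrite ler_wpM2r// exprn_ge0.
by rewrite exprS; lra.
Qed.

End square_roots.

(** * Means of the kernels and of their square roots *)

Section kernels.
Context {R : realType}.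
Implicit Types (f h a : G -> R) (x y t u : G).

Lemma mean_rademacherM M s h : (s < M)%N -> dep s h -> mean M (fun x => rademacher s x *
    h x) = 0.
Proof.
move=> sM hs; apply: (@aver_odd _ _ _ s); first by rewrite mem_index_iota.
move=> x; rewrite (dep_flip hs)// /rademacher /flip eqxx addbT.
by case: (x s); rewrite /= ?expr1 ?expr0 ?mulN1r ?mul1r ?opprK.
Qed.

Lemma mean_fejer_sum_pow2 M j : (j <= M)%N -> mean M (@fejer_sum R (2 ^ j)) = 2 ^+ j.
Proof.
elim: j => [|j IH] jM.
  rewrite expn0 (@eq_mean _ _ _ (fun=> 1)) ?mean_cst// => x.
  by rewrite fejer_sumS fejer_sum0 add0r dirichletS dirichlet0 add0r walsh0.
rewrite (@eq_mean _ _ _ (fun x => (fejer_sum (2 ^ j) x + rademacher j x * fejer_sum (2 ^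
    j) x) +
    4 ^+ j * (agree j origin x)%:R)); last by move=> x; rewrite fejer_sum_pow2S; ring.
rewrite !meanD meanZ mean_agree ?(ltnW jM)// IH ?(ltnW jM)// mean_rademacherM//; last first.
  exact: dep_fejer_sum.
rewrite -exprMn (_ : 4 / 2 = 2 :> R); first by rewrite exprS; lra.
by lra.
Qed.

Lemma mean_majorant M j : (j <= M)%N -> mean M (@majorant R j) = 2 * 2 ^+ j.
Proof.
move=> jM; rewrite /majorant meanD meanZ mean_fejer_sum_pow2// mean_agree// -exprMn.
rewrite (_ : 4 / 2 = 2 :> R); lra.
Qed.

(** Under the doubling recursion the kernel is doubled on one half of the group and erased on the
    other, so the mean of its square root is multiplied by [sqrt 2 / 2 <= 3 / 4]; the new term adds
    [2 ^+ j * 2^-1 ^+ j = 1]. The bound 4 is the fixed point of a -> 3a/4 + 1. *)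
Lemma mean_sqrt_fejer_sum_pow2 M j : (j <= M)%N -> mean M (fun x => sqrt (@fejer_sum R (2
    ^ j) x)) <= 4.
Proof.
elim: j => [|j IH] jM.
  rewrite expn0 (@eq_mean _ _ _ (fun=> 1)) ?mean_cst; first by lra.
  by move=> x; rewrite fejer_sumS fejer_sum0 add0r dirichletS dirichlet0 add0r walsh0
      sqrtr1.
(* The weight [3 / 4 + 3 / 4 * rademacher j x] is 0 or [3 / 2], the latter being at least [sqrt 2];
   its Rademacher part has mean zero. *)
apply: (@le_trans _ _ (mean M (fun x => 3 / 4 * sqrt (fejer_sum (2 ^ j) x) +
    3 / 4 * (rademacher j x * sqrt (fejer_sum (2 ^ j) x)) + 2 ^+ j * (agree j origin
        x)%:R))).
  apply: ler_mean => x; rewrite fejer_sum_pow2S; apply: le_trans (sqrtD_le _ _) _.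
  - rewrite mulr_ge0 ?fejer_sum_pow2_ge0// /rademacher; case: (x j); rewrite ?expr1
      ?expr0; lra.
  - by rewrite mulr_ge0// exprn_ge0.
  rewrite lerD//; last first.
    rewrite (_ : 4 = 2 * 2 :> R); last by ring.
    rewrite exprMn -expr2; case: agree; rewrite ?mulr0 ?sqrtr0// !mulr1.
    by rewrite sqrtr_sqr ger0_norm// exprn_ge0.
  rewrite /rademacher; case: (x j); rewrite ?expr1 ?expr0.
    by rewrite subrr mul0r sqrtr0; lra.
  rewrite mul1r sqrtrM; last by lra.
  apply: (@le_trans _ _ (3 / 2 * sqrt (fejer_sum (2 ^ j) x))); last by lra.
  by rewrite ler_wpM2r ?sqrtr_ge0//; exact: sqrt2_le.
rewrite !meanD !meanZ mean_rademacherM//; last first.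
  by move=> x y xy; rewrite (dep_fejer_sum (leqnn _) xy).
rewrite mean_agree ?(ltnW jM)// -exprMn divff// expr1n mulr0 addr0.
by have := IH (ltnW jM); lra.
Qed.

Lemma mean_sqrt_majorant M j : (j <= M)%N -> mean M (fun x => sqrt (@majorant R j x)) <= 5.
Proof.
move=> jM; apply: (@le_trans _ _ (mean M (fun x => sqrt (fejer_sum (2 ^ j) x) +
    2 ^+ j * (agree j origin x)%:R))).
  apply: ler_mean => x; apply: le_trans (sqrtD_le (fejer_sum_pow2_ge0 _ _) _) _.
    by rewrite mulr_ge0// exprn_ge0.
  rewrite lerD2l (_ : 4 = 2 * 2 :> R); last by ring.
  rewrite exprMn -expr2; case: agree; rewrite ?mulr0 ?sqrtr0// !mulr1.
  by rewrite sqrtr_sqr ger0_norm// exprn_ge0.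
rewrite meanD meanZ mean_agree// -exprMn divff// expr1n.
by have := mean_sqrt_fejer_sum_pow2 jM; lra.
Qed.

(** The means [2 * 2 ^+ j] of the majorants grow geometrically, so all ranks up to [s.+1] together
    cost at most [8 * 2 ^+ s], where [2 ^ s <= n]. *)
Lemma mean_norm_fejer_sum M n : (n < 2 ^ M)%N -> mean M (fun x => `|@fejer_sum R n x|) <=
    8 * n%:R.
Proof.
have [->|n0 nM] := posnP n.
  by move=> _; rewrite (@eq_mean _ _ _ (fun=> 0)) ?mean_cst ?mulr0// => x; rewrite
      fejer_sum0 normr0.
have /andP[ns sn] := trunc_log_bounds (isT : (1 < 2)%N) n0.
set s := trunc_log 2 n in ns sn.
have sM : (s < M)%N by rewrite -(@ltn_exp2l 2)//; apply: leq_ltn_trans nM.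
apply: (@le_trans _ _ (mean M (fun x => majorant 0 x + \sum_(1 <= j < s.+2) majorant j x))).
  apply: ler_mean => x; apply: le_trans (norm_fejer_sum_le _ sn) _.
  rewrite lerD2l big_mkcond; apply: ler_sum => j _; case: ifP => // _.
  exact: majorant_ge0.
rewrite meanD mean_sum mean_majorant//.
apply: (@le_trans _ _ (8 * 2 ^+ s)); last by rewrite ler_wpM2l// -natrX ler_nat.
have aux k : (k <= M)%N -> 2 * 2 ^+ 0 + \sum_(1 <= j < k.+1) mean M (@majorant R j) <= 2
    * 2 ^+ k.+1.
  elim: k => [|k IH] kM; first by rewrite big_geq//; lra.
  rewrite big_nat_recr//= addrA mean_majorant//.
  by have := IH (ltnW kM); rewrite !exprS; lra.
by apply: le_trans (aux s.+1 sM) _; rewrite !exprS; lra.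
Qed.

(* Off the cylinder of rank [N] around 0, averaging over the coordinates from [N]
   on collapses every higher kernel to the one of rank [N]. *)
Lemma cexp_majorant N M j y : (N <= M)%N -> (j <= M)%N -> ~~ agree N origin y ->
  cexp N M (@majorant R j) y = majorant (minn j N) y.
Proof.
move=> NM jM Ny; have [jN|Nj] := leqP j N.
  by rewrite cexp_fix//; apply: dep_leq jN _; exact: dep_majorant.
(* The Dirichlet part of [majorant j] lives on a cylinder inside the excluded one, so only the Fejer
   part matters at [y]. *)
suff H k : (N + k <= M)%N -> cexp N M (@fejer_sum R (2 ^ (N + k))) y = fejer_sum (2 ^ N) y.
  have agN i z : (N <= i)%N -> ~~ agree N origin z -> (agree i origin z)%:R = 0 :> R.
    by move=> Ni Nz; case: (boolP (agree i origin z)) => // /(agree_leq Ni); rewrite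
        (negbTE Nz).
  rewrite /majorant; have := @averD R (index_iota N M) (fejer_sum (2 ^ j)) (fun x => 4 ^+
      j * (agree j origin x)%:R).
  rewrite /cexp => ->; have := H (j - N)%N; rewrite subnKC ?(ltnW Nj)//.
  rewrite /cexp => ->//; rewrite averZ agN// mulr0 addr0.
  rewrite [X in aver _ X](_ : _ = fun x => (agree N origin x)%:R * (agree j origin
      x)%:R); last first.
    apply/funext => x; have [|xN] := boolP (agree N origin x); first by rewrite mul1r.
    by rewrite agN ?mul0r// ltnW.
  have := @cexpM R N M _ (fun x => (agree j origin x)%:R) (@dep_agree R N origin).
  by rewrite /cexp => ->; rewrite (negbTE Ny) mul0r mulr0 addr0.
elim: k => [|k IH] kM.
  by rewrite addn0 cexp_fix//; exact: dep_fejer_sum.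
rewrite addnS.
(* Inserting the factor [agree N origin x] changes nothing, but [cexpM] can pull it out, and it
   vanishes at [y]; the Rademacher term averages to zero. Hence a doubling leaves the conditional
   expectation unchanged. *)
rewrite [X in cexp _ _ X](_ : _ = fun x => (fejer_sum (2 ^ (N + k)) x +
   rademacher (N + k) x * fejer_sum (2 ^ (N + k)) x) + (agree N origin x)%:R *
   (4 ^+ (N + k) * (agree (N + k) origin x)%:R)); last first.
  apply/funext => x; rewrite fejer_sum_pow2S mulrDl mul1r; congr (_ + _).
  have [|xN] := boolP (agree N origin x); first by rewrite mul1r.
  rewrite mul0r; case: (boolP (agree (N + k) origin x)); last by rewrite mulr0.
  by move=> /(agree_leq (leq_addr _ _)); rewrite (negbTE xN).
rewrite /cexp averD averD.
have := @cexpM R N M _ (fun x => 4 ^+ (N + k) * (agree (N + k) origin x)%:R) (@dep_agree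
    R N origin).
rewrite /cexp => ->; rewrite (negbTE Ny) mul0r addr0 -/(cexp _ _ _) IH; last first.
  by rewrite addnS in kM; exact: ltnW.
rewrite (@aver_odd _ _ _ (N + k)) ?addr0//.
  by rewrite mem_index_iota leq_addr -addnS.
move=> x; rewrite (dep_flip (dep_fejer_sum (leqnn _)))// /rademacher /flip eqxx addbT.
by case: (x _); rewrite /= ?expr1 ?expr0 ?mulN1r ?mul1r ?opprK.
Qed.

End kernels.

(** * Atoms *)

Section fejer_means.
Context {R : realType}.
Implicit Types (f h a : G -> R) (x y t u : G).

(** Every element of the group is its own inverse, so [addg x t] is also the difference of [x] and
    [t], and this is convolution with [n] times the Fejer kernel. *)
Definition conv M f n x : R := mean M (fun t => f t * fejer_sum n (addg x t)).
Definition fejer M f n x : R := n%:R^-1 * conv M f n x.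

Lemma dep_addg M f x : dep M f -> dep M (fun t => f (addg x t)).
Proof. by move=> fM y z yz; apply: fM => j jM; rewrite /addg yz. Qed.

Lemma conv_sum M (I : Type) (r : seq I) (P : pred I) (F : I -> G -> R) n x :
  conv M (fun t => \sum_(i <- r | P i) F i t) n x = \sum_(i <- r | P i) conv M (F i) n x.
Proof.
by rewrite /conv -mean_sum; apply: eq_mean => t; rewrite mulr_suml.
Qed.

Lemma convD M f h n x : conv M (fun t => f t + h t) n x = conv M f n x + conv M h n x.
Proof. by rewrite /conv -meanD; apply: eq_mean => t; rewrite mulrDl. Qed.

Lemma fejer_linear_sum M (I : Type) (r : seq I) (P : pred I) (F : I -> G -> R) n x :
  fejer M (fun t => \sum_(i <- r | P i) F i t) n x = \sum_(i <- r | P i) fejer M (F i) n x.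
Proof. by rewrite /fejer conv_sum mulr_sumr. Qed.

Lemma fejerD M f h n x : fejer M (fun t => f t + h t) n x = fejer M f n x + fejer M h n x.
Proof. by rewrite /fejer convD mulrDr. Qed.

Lemma dep_conv M f n : (n <= 2 ^ M)%N -> dep M (conv M f n).
Proof.
move=> nM x y xy; rewrite /conv; apply: eq_mean => t; congr (_ * _).
by apply: (dep_fejer_sum nM) => j jM; rewrite /addg xy.
Qed.

Lemma dep_fejer M f n : (n <= 2 ^ M)%N -> dep M (fejer M f n).
Proof. by move=> nM x y xy; rewrite /fejer (dep_conv _ nM xy). Qed.

Lemma norm_conv_le M f n x lam : (n < 2 ^ M)%N -> (forall t, `|f t| <= lam) ->
  `|conv M f n x| <= lam * (8 * n%:R).
Proof.
move=> nM fl; have lam0 : 0 <= lam by apply: le_trans (fl origin).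
apply: le_trans (ler_norm_mean _ _) _.
apply: (@le_trans _ _ (mean M (fun t => lam * `|fejer_sum n (addg x t)|))).
  by apply: ler_mean => t; rewrite normrM ler_wpM2r.
rewrite meanZ ler_wpM2l//.
rewrite (@mean_shift _ _ (fun y => `|fejer_sum n y|)); first exact: mean_norm_fejer_sum.
by move=> y z yz; rewrite (dep_fejer_sum (ltnW nM) yz).
Qed.

Lemma norm_fejer_le M f n x lam : (0 < n < 2 ^ M)%N -> (forall t, `|f t| <= lam) ->
  `|fejer M f n x| <= 8 * lam.
Proof.
move=> /andP[n0 nM] fl; rewrite /fejer normrM ger0_norm ?invr_ge0//.
rewrite ler_pdivrMl ?ltr0n//; have := norm_conv_le x nM fl; lra.
Qed.

Section atom.
Variables (M N : nat) (u : G) (a : G -> R) (lam : R).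
Hypothesis NM : (N <= M)%N.
Hypothesis aM : dep M a.
Hypothesis a_supp : forall x, ~~ agree N u x -> a x = 0.
Hypothesis a_le : forall x, `|a x| <= lam.
Hypothesis a_mean : forall x, cexp N M a x = 0.

(** The kernel depends only on the first [N] coordinates, so conditioning at rank [N] makes the
    cancellation [a_mean] act directly on [a]. *)
Lemma conv_atom_small n x : (n <= 2 ^ N)%N -> conv M a n x = 0.
Proof.
move=> nN; rewrite /conv -(@mean_cexp _ N)//.
  rewrite (@eq_mean _ _ _ (fun=> 0)) ?mean_cst// => t.
  have -> : (fun t => a t * fejer_sum n (addg x t)) = (fun t => fejer_sum n (addg x t) *
      a t).
    by apply/funext => z; rewrite mulrC.
  rewrite cexpM ?a_mean ?mulr0//; apply: dep_addg; exact: dep_fejer_sum.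
move=> y z yz; rewrite (aM yz); congr (_ * _).
have VM : dep M (@fejer_sum R n) by apply: dep_fejer_sum; rewrite (leq_trans nN)//
    leq_exp2l.
exact: (dep_addg x VM yz).
Qed.

(** Only size and support of [a] enter: integrating a majorant over the cylinder of [u] gives
    [2^-1 ^+ N] times its conditional expectation at [addg x u], a point outside the cylinder of
    [origin], where [cexp_majorant] applies. *)
Lemma conv_atom n s x : (n < 2 ^ s.+1)%N -> (s < M)%N -> ~~ agree N u x ->
  `|conv M a n x| <= lam * 2^-1 ^+ N *
     (majorant 0 (addg x u) + \sum_(1 <= j < M.+1 | jump n j) majorant (minn j N) (addg x
         u)).
Proof.
move=> ns sM xu; have lam0 : 0 <= lam by apply: le_trans (a_le origin).
apply: le_trans (ler_norm_mean _ _) _.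
apply: (@le_trans _ _ (mean M (fun t => lam * ((agree N u t)%:R * majorant 0 (addg x t)) +
   lam * \sum_(1 <= j < M.+1 | jump n j) ((agree N u t)%:R * majorant j (addg x t))))).
  apply: ler_mean => t; rewrite normrM -mulr_sumr -!mulrDr.
  have [tu|tu] := boolP (agree N u t); last first.
    by rewrite a_supp// normr0 !mul0r mulr0.
  rewrite mul1r ler_pM//; apply: le_trans (norm_fejer_sum_le _ ns) _.
  rewrite lerD2l [leRHS](@big_cat_nat _ _ _ s.+2)//= lerDl sumr_ge0// => j _.
  exact: majorant_ge0.
have mg j : (j <= M)%N -> mean M (fun t => (agree N u t)%:R * majorant j (addg x t)) =
    2^-1 ^+ N * majorant (minn j N) (addg x u) :> R.
  move=> jM; rewrite mean_agreeM//; last first.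
    by apply: dep_addg; apply: dep_leq jM _; exact: dep_majorant.
  rewrite /cexp aver_addg -/(cexp _ _ _) cexp_majorant//.
  by rewrite agree_addg; apply: contra xu => /agreeP H; apply/agreeP => j' /H.
rewrite meanD !meanZ mean_sum mg// min0n -mulrDr -mulrA ler_wpM2l//.
rewrite [leRHS]mulrDr lerD2l mulr_sumr le_eqVlt; apply/orP; left; apply/eqP.
rewrite big_nat_cond [RHS]big_nat_cond; apply: eq_bigr => j /andP[/andP[_ jM] _].
by apply: mg; rewrite -ltnS.
Qed.

Section maximal.
Variables (K c : nat) (n_ : nat -> nat) (T : nat -> pred nat).
Hypothesis nM : forall k, (k < K)%N -> (0 < n_ k < 2 ^ M)%N.
Hypothesis nT : forall k s, (k < K)%N -> (2 ^ s <= n_ k < 2 ^ s.+1)%N ->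
  {subset jump (n_ k) <= T s}.
Hypothesis Tc : forall s, (count (T s) (index_iota 1 M.+1) <= c)%N.

(** Since [T s] contains the jumps of every [n_ k] in the dyadic block [s], a single function serves
    the whole block, and its mean depends on [c] alone. *)
Let H s y := sqrt (majorant 0 y) + \sum_(1 <= j < M.+1 | T s j) sqrt (@majorant R (minn j
    N) y).

Let H_ge0 s y : 0 <= H s y.
Proof. by rewrite addr_ge0 ?sqrtr_ge0// sumr_ge0// => i _; rewrite sqrtr_ge0. Qed.

Let dep_H s : dep M (H s).
Proof.
move=> x y xy; rewrite /H (dep_leq (leq0n M) (@dep_majorant R 0) xy); congr (_ + _).
apply: eq_bigr => j _; rewrite (dep_leq _ (@dep_majorant R (minn j N)) xy)//.
by apply: leq_trans NM; rewrite geq_minr.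
Qed.

Let mean_H s : mean M (H s) <= 5 * c.+1%:R.
Proof.
rewrite /H meanD mean_sum -(natr1 c) [leRHS]mulrDr mulr1 addrC lerD ?mean_sqrt_majorant//.
apply: (@le_trans _ _ (\sum_(1 <= j < M.+1 | T s j) 5)).
  by apply: ler_sum => j _; apply: mean_sqrt_majorant; apply: leq_trans NM; rewrite
      geq_minr.
by rewrite big_const_seq iter_addr_0 -[leLHS]mulr_natr ler_wpM2l// ler_nat.
Qed.

(** On the cylinder the bound [8 * lam <= 9 * lam] costs [3 * sqrt lam]. Off it, blocks [s < N]
    contribute nothing and a block [s >= N] contributes at most
    [sqrt lam * theta ^+ s * theta ^+ N * H s]. Summing over [s] replaces the maximum over [k]; then
    20 is 4 from [sum_theta] times 5 from [mean_H], and passing from [c.+1] to [c.+2] absorbs the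
    3. *)
Lemma atom_maximal :
  mean M (fun x => sqrt (\big[Num.max/0]_(k < K) `|fejer M a (n_ k) x|)) <=
  20 * c.+2%:R * sqrt lam * 2^-1 ^+ N.
Proof.
have lam0 : 0 <= lam by apply: le_trans (a_le origin).
pose L x := sqrt lam * (3 * (agree N u x)%:R +
   \sum_(N <= s < N + (M - N)) theta ^+ s * theta ^+ N * H s (addg x u)).
have sum_ge0 x : 0 <= \sum_(N <= s < N + (M - N)) theta ^+ s * theta ^+ N * H s (addg x u).
  by apply: sumr_ge0 => s _; rewrite !mulr_ge0 ?exprn_ge0 ?theta_ge0.
apply: (@le_trans _ _ (mean M L)).
  apply: ler_mean => x; apply: sqrt_bigmax_le.
    by rewrite mulr_ge0 ?sqrtr_ge0// addr_ge0// mulr_ge0.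
  move=> [k kK] _ /=; have /andP[n0 n2M] := nM kK.
  have [ux|ux] := boolP (agree N u x).
    apply: (@le_trans _ _ (sqrt lam * 3)); last first.
      by rewrite /L ux ler_wpM2l ?sqrtr_ge0// /= mulr1 lerDl.
    have : `|fejer M a (n_ k) x| <= lam * 3 ^+ 2.
      have := norm_fejer_le x (nM kK) a_le; lra.
    move/ler_wsqrtr/le_trans; apply; rewrite sqrtrM// sqrtr_sqr ger0_norm//.
  have /andP[ns sn] := trunc_log_bounds (isT : (1 < 2)%N) n0.
  set s := trunc_log 2 (n_ k) in ns sn.
  have sM : (s < M)%N by rewrite -(@ltn_exp2l 2)//; apply: leq_ltn_trans n2M.
  rewrite /L (negbTE ux) mulr0 add0r.
  have [sN|Ns] := ltnP s N.
    rewrite /fejer conv_atom_small ?mulr0 ?normr0 ?sqrtr0 ?mulr_ge0 ?sqrtr_ge0//.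
    by apply: leq_trans (ltnW sn) _; rewrite leq_exp2l.
  apply: (@le_trans _ _ (sqrt lam * (theta ^+ s * theta ^+ N * H s (addg x u)))); last
      first.
    rewrite ler_wpM2l ?sqrtr_ge0// (bigD1_seq s) ?iota_uniq ?mem_index_iota ?Ns ?subnKC//=.
    by rewrite lerDl sumr_ge0// => i _; rewrite !mulr_ge0 ?exprn_ge0 ?theta_ge0.
  have := conv_atom sn sM ux.
  set S := (X in _ * X) => cS.
  have S0 : 0 <= S by rewrite addr_ge0 ?majorant_ge0// sumr_ge0// => i _; rewrite
      majorant_ge0.
  have : `|fejer M a (n_ k) x| <= lam * (2^-1 ^+ s * (2^-1 ^+ N * S)).
    rewrite /fejer normrM ger0_norm ?invr_ge0// mulrCA ler_pM ?invr_ge0//; last by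
        rewrite mulrA.
    by rewrite exprVn lef_pV2 ?posrE ?exprn_gt0 ?ltr0n// -natrX ler_nat.
  move/ler_wsqrtr/le_trans; apply.
  have i0 n : 0 <= 2^-1 ^+ n :> R by rewrite exprn_ge0 ?invr_ge0.
  rewrite !sqrtrM ?i0// !sqrt_halfX -mulrA !ler_wpM2l ?sqrtr_ge0 ?exprn_ge0 ?theta_ge0//.
  apply: le_trans (sqrtD_le _ _) _; rewrite ?majorant_ge0//.
    by rewrite sumr_ge0// => i _; rewrite majorant_ge0.
  rewrite lerD2l; apply: le_trans (sqrt_sum_le _ _ _) _; first by move=> i; rewrite
      majorant_ge0.
  rewrite big_mkcond [leRHS]big_mkcond /=; apply: ler_sum => j _.
  have [jj|_] := boolP (jump (n_ k) j); last by case: ifP => // _; rewrite sqrtr_ge0.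
  by have := nT kK (introT andP (conj ns sn)) jj; rewrite unfold_in => ->.
rewrite /L meanZ meanD meanZ mean_agree// mean_sum.
apply: (@le_trans _ _ (sqrt lam * (3 * 2^-1 ^+ N +
  \sum_(N <= s < N + (M - N)) theta ^+ s * (theta ^+ N * (5 * c.+1%:R))))).
  rewrite ler_wpM2l ?sqrtr_ge0// lerD2l; apply: ler_sum => s _.
  rewrite meanZ -mulrA !ler_wpM2l ?exprn_ge0 ?theta_ge0//.
  rewrite (@eq_mean _ _ _ (fun x => H s (addg u x))); last by move=> x; rewrite addgC.
  by rewrite mean_shift.
rewrite -mulr_suml [leRHS]mulrAC [leRHS]mulrC ler_wpM2l ?sqrtr_ge0//.
have := @sum_theta R N (M - N); set S := (X in X <= _) => SL.
have : S * (theta ^+ N * (5 * c.+1%:R)) <= 4 * theta ^+ N * (theta ^+ N * (5 * c.+1%:R)).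
  by rewrite ler_wpM2r// !mulr_ge0// exprn_ge0// theta_ge0.
have -> : 4 * theta ^+ N * (theta ^+ N * (5 * c.+1%:R)) = 20 * c.+1%:R * 2^-1 ^+ N :> R.
  rewrite -[in RHS]theta_sq exprMn; ring.
have : 0 <= 2^-1 ^+ N :> R by rewrite exprn_ge0 ?invr_ge0.
rewrite -/S (_ : c.+2%:R = c.+1%:R + 1 :> R); last by rewrite natr1.
have key (p q z : R) : 0 <= p -> q <= 20 * z * p -> 3 * p + q <= 20 * (z + 1) * p.
  by move=> p0 qp; lra.
exact: (@key (2^-1 ^+ N) _ (c.+1%:R)).
Qed.

End maximal.
End atom.
End fejer_means.

(** * Stopping times and the maximal inequality *)

Section maximal_mean.
Context {R : realType}.
Implicit Types (f h a : G -> R) (x y t u : G).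

Lemma mean_flip M j h : (j < M)%N -> mean M (fun x => h (flip j x)) = mean M h.
Proof.
move=> jM; rewrite /mean /cexp aver_flip aver_inv//.
by rewrite mem_index_iota.
Qed.

(** The digits of the numbers [p < 2 ^ N] enumerate the prefixes of length [N], so these cylinders
    partition the group. *)
Lemma sum_agree N x : \sum_(0 <= p < 2 ^ N) (agree N (bit p) x)%:R = 1 :> R.
Proof.
elim: N => [|N IH]; first by rewrite expn0 big_nat1.
rewrite expnS mul2n -addnn (@big_cat_nat _ _ _ (2 ^ N))//= ?leq_addr//.
rewrite -{2}(add0n (2 ^ N)%N) big_addn addnK -big_split /= -[RHS]IH.
apply: eq_big_nat => p /andP[_ pN]; rewrite !agreeS addnC bitDs//.
rewrite (bit_small pN (leqnn N)).
rewrite (_ : agree N (bit (2 ^ N + p)) x = agree N (bit p) x); last first.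
  by apply/agreeP/agreeP => H j jN; rewrite H// bitDl.
by case: (x N); case: agree; rewrite ?addr0 ?add0r.
Qed.

Variables (M K : nat) (n_ : nat -> nat).

Definition max_fejer f x : R := \big[Num.max/0]_(k < K) `|fejer M f (n_ k) x|.
Definition mean_sqrt_fejer f : R := mean M (fun x => sqrt (max_fejer f x)).

Lemma max_fejer_ge f x (k : 'I_K) : `|fejer M f (n_ k) x| <= max_fejer f x.
Proof. exact: (le_bigmax _ (fun k : 'I_K => `|fejer M f (n_ k) x|)). Qed.

Lemma mean_sqrt_fejer_le f (L : G -> R) : (forall x, 0 <= L x) ->
  (forall x (k : 'I_K), sqrt `|fejer M f (n_ k) x| <= L x) -> mean_sqrt_fejer f <= mean M L.
Proof. by move=> L0 fL; apply: ler_mean => x; apply: sqrt_bigmax_le => // i _. Qed.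

Lemma mean_sqrt_fejer_sum (I : Type) (r : seq I) (P : pred I) (F : I -> G -> R) :
  mean_sqrt_fejer (fun x => \sum_(i <- r | P i) F i x) <= \sum_(i <- r | P i)
      mean_sqrt_fejer (F i).
Proof.
rewrite -mean_sum; apply: mean_sqrt_fejer_le => [x|x k].
  by rewrite sumr_ge0// => i _; rewrite sqrtr_ge0.
rewrite fejer_linear_sum.
apply: (@le_trans _ _ (sqrt (\sum_(i <- r | P i) `|fejer M (F i) (n_ k) x|))).
  by rewrite ler_wsqrtr// ler_norm_sum.
apply: le_trans (sqrt_sum_le _ _ _) _ => //.
by apply: ler_sum => i _; rewrite ler_wsqrtr// max_fejer_ge.
Qed.

Lemma mean_sqrt_fejerD f h : mean_sqrt_fejer (fun x => f x + h x) <= mean_sqrt_fejer f +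
    mean_sqrt_fejer h.
Proof.
rewrite -meanD; apply: mean_sqrt_fejer_le => [x|x k]; first by rewrite addr_ge0 ?sqrtr_ge0.
rewrite fejerD; apply: le_trans (ler_wsqrtr (ler_normD _ _)) _.
by apply: le_trans (sqrtD_le _ _) _ => //; rewrite lerD ?ler_wsqrtr ?max_fejer_ge.
Qed.

End maximal_mean.

(** A layer-cake bound: powers of 2 below [y] sum to less than twice the largest of them. It turns
    the sum over stopping levels back into the maximal function. *)
Lemma sum_pow2 {R : realType} (y : R) L : 0 <= y ->
  \sum_(0 <= k < L) 2 ^+ k * (2 ^+ k < y)%R%:R <= 2 * y.
Proof.
move=> y0; elim: L => [|L IH]; first by rewrite big_geq// mulr_ge0.
rewrite big_nat_recr//=; have [Ly|Ly] := ltP (2 ^+ L) y; last by rewrite mulr0 addr0.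
rewrite mulr1.
have aux l : \sum_(0 <= k < l) 2 ^+ k * (2 ^+ k < y)%R%:R <= 2 ^+ l - 1 :> R.
  elim: l => [|l IHl]; first by rewrite big_geq// expr0 subrr.
  rewrite big_nat_recr//= exprS.
  have : 2 ^+ l * (2 ^+ l < y)%R%:R <= 2 ^+ l :> R.
    by case: ltP => _; rewrite ?mulr1 ?mulr0// exprn_ge0.
  lra.
by have := aux L; lra.
Qed.

Section stopping.
Context {R : realType}.
Implicit Types (h : G -> R) (x y : G) (lam : R).
Variables (M : nat) (f : G -> R).
Hypothesis fM : dep M f.

Let E n := cexp n M f.

Let dep_E n : (n <= M)%N -> dep n (E n).
Proof. by move=> nM; apply: cexp_dep. Qed.

Definition martingale_max x := \big[Num.max/0]_(n < M.+1) `|E n x|.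

Lemma martingale_max_ge n x : (n <= M)%N -> `|E n x| <= martingale_max x.
Proof.
by move=> nM; apply: (le_bigmax _ (fun n : 'I_M.+1 => `|E n x|) (Ordinal (nM : (n <
    M.+1)%N))).
Qed.

(* Looking at both children of the rank [n] cylinder makes [peak n] depend on the
   first [n] coordinates only, so that [tau] below stops before the jump. *)
Let peak n x := Num.max `|E n.+1 x| `|E n.+1 (flip n x)|.

Let dep_peak n : (n < M)%N -> dep n (peak n).
Proof.
move=> nM.
(* [peak n] is symmetric under [flip n], hence equal to its own average over coordinate [n]. *)
suff <- : avg n (peak n) = peak n.
  apply: dep_avg => x y xy; rewrite /peak (dep_E nM xy).
  by rewrite (dep_E nM (x := flip n x) (y := flip n y))// => j jn; rewrite /flip xy.
by apply/funext => x; rewrite /avg /peak flipK [X in _ + X]maxC; lra.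
Qed.

(** When no peak exceeds [lam], [find] returns the length [M] of the list, which stands for never
    stopping. *)
Let tau lam x := find (fun n => lam < peak n x) (iota 0 M).

Let tau_le lam x : (tau lam x <= M)%N.
Proof. by rewrite /tau -[leqRHS](size_iota 0) find_size. Qed.

Let tau_before lam x n : (n < tau lam x)%N -> peak n x <= lam.
Proof.
move=> nt; have /negbT := before_find 0%N nt.
by rewrite nth_iota ?add0n -?leNgt//; apply: leq_trans nt (tau_le _ _).
Qed.

Let tau_at lam x : (tau lam x < M)%N -> lam < peak (tau lam x) x.
Proof.
move=> tM; have := @nth_find _ 0%N (fun n => lam < peak n x) (iota 0 M).
rewrite has_find size_iota => /(_ tM); rewrite nth_iota//.
Qed.

Let ltn_tau lam x n : (n < M)%N ->
  (n < tau lam x)%N = all (fun i => peak i x <= lam) (iota 0 n.+1).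
Proof.
move=> nM; apply/idP/allP => [nt i|H].
  by rewrite mem_iota ltnS => /= ni; apply: tau_before; apply: leq_ltn_trans nt.
rewrite ltnNge; apply/negP => tn.
have := tau_at (leq_ltn_trans tn nM); rewrite ltNge => /negP; apply.
by apply: H; rewrite mem_iota /= ltnS.
Qed.

Let dep_ltn_tau lam n : (n < M)%N -> dep n (fun x => (n < tau lam x)%:R : R).
Proof.
move=> nM x y xy; rewrite !ltn_tau//; congr (_%:R); congr nat_of_bool.
apply: eq_in_all => i; rewrite mem_iota ltnS => /= ni.
rewrite (dep_peak (leq_ltn_trans ni nM) (x := x) (y := y))// => j ji.
by apply: xy; apply: leq_trans ni.
Qed.

Let dep_eq_tau lam n : (n < M)%N -> dep n (fun x => (tau lam x == n)%:R : R).
Proof.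
move=> nM x y xy.
have H z : (tau lam z == n)%:R =
    (if n is m.+1 then (m < tau lam z)%:R else 1) * (1 - (n < tau lam z)%:R) :> R.
  have -> : (tau lam z == n) =
      (if n is m.+1 then (m < tau lam z)%N else true) && ~~ (n < tau lam z)%N.
    by case: (n) => [|m]; lia.
  by case: (n < _)%N; rewrite /= ?andbT ?andbF ?subrr ?mulr0// subr0 mulr1; case: (n).
rewrite !H (dep_ltn_tau lam nM xy); congr (_ * _).
case: n nM xy {H} => // m nM xy.
by apply: (dep_ltn_tau lam (ltnW nM)) => j jm; apply: xy; apply: ltnW.
Qed.

Let E_tau lam x n : `|E 0 x| <= lam -> (n <= tau lam x)%N -> `|E n x| <= lam.
Proof.
case: n => // n _ nt; apply: le_trans (tau_before nt).
by rewrite /peak le_max lexx.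
Qed.

Let tau_mono lam lam' x : lam <= lam' -> (tau lam x <= tau lam' x)%N.
Proof.
move=> ll; rewrite leqNgt; apply/negP => tt.
have := tau_at (leq_trans tt (tau_le _ _)).
by rewrite ltNge (le_trans (tau_before tt) ll).
Qed.

Let stop lam x := E (tau lam x) x.

(** The part of [stop lam' - stop lam] on the event that [tau lam] equals [N], where [stop lam] is
    [E N]. The event is a union of cylinders of rank [N], so cutting along them yields atoms. *)
Let piece lam lam' N x := (tau lam x == N)%:R * (stop lam' x - E N x).

(** Telescoping of the martingale up to [tau lam']. The factor [n < tau lam'] depends on the first
    [n] coordinates, so each difference separately has conditional mean zero. *)
Let pieceE lam lam' N x : lam <= lam' ->
  piece lam lam' N x = (tau lam x == N)%:R *
    \sum_(N <= n < M) (n < tau lam' x)%:R * (E n.+1 x - E n x).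
Proof.
move=> ll; rewrite /piece; have [tN|] := eqVneq (tau lam x) N; last by rewrite !mul0r.
rewrite !mul1r; have Nt : (N <= tau lam' x)%N by rewrite -tN tau_mono.
rewrite (@big_cat_nat _ _ _ (tau lam' x))//= [X in _ = _ + X]big_nat_cond [X in _ = _ +
    X]big1; last first.
  by move=> i /andP[/andP[ti _] _]; rewrite ltnNge ti mul0r.
rewrite addr0 (@eq_big_nat _ _ _ _ _ _ (fun n => E n.+1 x - E n x)).
  by rewrite telescope_sumr.
by move=> i /andP[_ ->]; rewrite mul1r.
Qed.

Let piece_mean lam lam' N x : lam <= lam' -> (N < M)%N ->
  cexp N M (piece lam lam' N) x = 0.
Proof.
move=> ll NM.
rewrite (_ : piece lam lam' N = fun x => (tau lam x == N)%:R *
  \sum_(N <= n < M) (n < tau lam' x)%:R * (E n.+1 x - E n x)); last first.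
  by apply/funext => y; exact: pieceE.
rewrite cexpM; last exact: dep_eq_tau.
rewrite /cexp aver_sum big_nat big1 ?mulr0// => n /andP[Nn nM].
rewrite -/(cexp N M _) (@cexp_cat _ N n) ?Nn ?(ltnW nM)// cexpM; last exact: dep_ltn_tau.
rewrite (_ : (fun y => _) = fun=> 0); first by rewrite /cexp aver_cst.
apply/funext => y; rewrite /cexp averB -!/(cexp _ _ _) /E.
by rewrite !cexp_idem ?leqnn ?leqnSn ?(ltnW nM)// subrr mulr0.
Qed.

Let dep_stop lam : dep M (stop lam).
Proof.
move=> x y xy.
have -> : stop lam x = E (tau lam y) x.
  rewrite /stop; congr (E _ _); rewrite /tau; apply: eq_in_find => n.
  rewrite mem_iota /= add0n => nM; rewrite (dep_peak nM (x := x) (y := y))//.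
  by move=> j jn; apply: xy; apply: ltn_trans nM.
by apply: (dep_leq (tau_le lam y) (dep_E (tau_le lam y))).
Qed.

Let dep_piece lam lam' N : (N < M)%N -> dep M (piece lam lam' N).
Proof.
move=> NM x y xy; rewrite /piece (dep_stop lam' xy).
rewrite (dep_leq (ltnW NM) (dep_E (ltnW NM)) xy).
by have := dep_leq (ltnW NM) (dep_eq_tau lam NM) xy => /= ->.
Qed.

(** If [tau lam x] is [N], the level is exceeded at [x] or at its sibling [flip N x], and both
    belong to the event. So at least half of the event lies where [lam < martingale_max]; the factor
    2 is the price of stopping before the jump. *)
Let mean_tau lam : \sum_(0 <= N < M) mean M (fun x => (tau lam x == N)%:R : R) <=
  2 * mean M (fun x => (lam < martingale_max x)%R%:R : R).
Proof.
apply: (@le_trans _ _ (\sum_(0 <= N < M) 2 * mean M (fun x =>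
    (tau lam x == N)%:R * (lam < martingale_max x)%R%:R : R))).
  rewrite big_nat [leRHS]big_nat; apply: ler_sum => N /andP[_ NM].
  pose h x : R := (tau lam x == N)%:R * (lam < martingale_max x)%R%:R.
  have -> : 2 * mean M h = mean M (fun x => h x + h (flip N x)).
    by rewrite meanD mean_flip// mulr_natl.
  apply: ler_mean => x; rewrite /h.
  have := dep_flip (dep_eq_tau lam NM) (leqnn N) x => /= ->.
  have [tN|_] := eqVneq (tau lam x) N; last by rewrite !mul0r addr0.
  have := @tau_at lam x; rewrite tN => /(_ NM); rewrite /peak lt_max !mul1r.
  have mm z : lam < `|E N.+1 z| -> lam < martingale_max z by move/lt_le_trans; apply;
      exact: martingale_max_ge.
  by move=> /orP[/mm ->|/mm ->]; rewrite ?lerDl ?lerDr.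
rewrite -mulr_sumr ler_wpM2l// -mean_sum; apply: ler_mean => x.
rewrite -mulr_suml; apply: ler_piMl => //.
have [tM|tM] := ltnP (tau lam x) M.
  rewrite (bigD1_seq (tau lam x)) ?iota_uniq ?mem_index_iota//= eqxx big1 ?addr0//.
  by move=> i; rewrite eq_sym => /negbTE ->.
rewrite big_nat big1 ?ler01// => i /andP[_ iM].
by rewrite gtn_eqF// (leq_trans iM).
Qed.


Section decomposition.
Variables (K c : nat) (n_ : nat -> nat) (T : nat -> pred nat).
Hypothesis nM : forall k, (k < K)%N -> (0 < n_ k < 2 ^ M)%N.
Hypothesis nT : forall k s, (k < K)%N -> (2 ^ s <= n_ k < 2 ^ s.+1)%N ->
  {subset jump (n_ k) <= T s}.
Hypothesis Tc : forall s, (count (T s) (index_iota 1 M.+1) <= c)%N.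

Let C : R := 20 * c.+2%:R.

Let C_ge0 : 0 <= C. Proof. by rewrite mulr_ge0. Qed.

Let mean_sqrt_fejer_piece lam N : `|E 0 origin| <= lam -> (N < M)%N ->
  mean_sqrt_fejer M K n_ (piece lam (4 * lam) N) <=
  3 * C * sqrt lam * mean M (fun x => (tau lam x == N)%:R : R).
Proof.
move=> E0 NM; have lam0 : 0 <= lam by apply: le_trans E0.
have ll : lam <= 4 * lam by lra.
have E0x x : `|E 0 x| <= lam by rewrite (dep_E (leq0n M) (y := origin)).
pose b p x : R := (agree N (bit p) x)%:R * piece lam (4 * lam) N x.
have -> : piece lam (4 * lam) N = fun x => \sum_(0 <= p < 2 ^ N) b p x.
  by apply/funext => x; rewrite -mulr_suml sum_agree mul1r.
apply: le_trans (mean_sqrt_fejer_sum _ _ _ _ _ _) _.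
have eqt p x : agree N (bit p) x -> (tau lam x == N)%:R = (tau lam (bit p) == N)%:R :> R.
  by move=> /agreeP H; apply: (dep_eq_tau lam NM).
(* Each piece is bounded by [4 * lam + lam], enlarged to [9 * lam] to have a rational square root
   factor; the indicator gives bound zero to cylinders outside the event. *)
apply: (@le_trans _ _ (\sum_(0 <= p < 2 ^ N)
    C * sqrt (9 * lam * (tau lam (bit p) == N)%:R) * 2^-1 ^+ N)).
  apply: ler_sum => p _; apply: (@atom_maximal _ _ _ (bit p) _ _ _ _ _ _ _ K c n_ T) => //.
  - exact: ltnW.
  - move=> x y xy; rewrite /b (dep_piece lam (4 * lam) NM xy).
    by rewrite (dep_leq (ltnW NM) (@dep_agree R N (bit p)) xy).
  - by move=> x /negbTE px; rewrite /b px mul0r.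
  - move=> x; rewrite /b; case: (boolP (agree _ _ _)) => px; last first.
      by rewrite mul0r normr0 !mulr_ge0.
    rewrite mul1r /piece -(eqt _ _ px) normrM ger0_norm// mulrC.
    have [tN|_] := eqVneq; last by rewrite !mulr0.
    rewrite !mulr1; apply: le_trans (ler_normB _ _) _.
    have e1 := E_tau (E0x x) (eq_leq (esym tN)).
    have e2 : `|stop (4 * lam) x| <= 4 * lam.
      by apply: E_tau => //; apply: le_trans ll.
    lra.
  - move=> x; rewrite cexpM; last exact: dep_agree.
    by rewrite piece_mean// mulr0.
rewrite (@eq_mean R M _ (fun x => \sum_(0 <= p < 2 ^ N)
    (agree N (bit p) x)%:R * (tau lam x == N)%:R : R)); last first.
  by move=> x; rewrite -mulr_suml sum_agree mul1r.
rewrite mean_sum mulr_sumr; apply: ler_sum => p _.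
rewrite mean_agreeM ?(ltnW NM)//; last first.
  exact: dep_leq (ltnW NM) (dep_eq_tau lam NM).
rewrite cexp_fix; last exact: dep_eq_tau.
rewrite le_eqVlt; apply/orP; left; apply/eqP.
rewrite sqrtrM ?mulr_ge0// sqrtrM// (_ : 9 = 3 ^+ 2 :> R); last by ring.
rewrite sqrtr_sqr ger0_norm//.
by case: eqVneq => _; rewrite /= ?sqrtr0 ?sqrtr1; ring.
Qed.

Lemma mean_sqrt_fejer_maximal : mean_sqrt_fejer M K n_ f <=
  (3 + 12 * C) * mean M (fun x => sqrt (martingale_max x)).
Proof.
apply/ler_addgt0Pr => e e0.
set B := mean M _.
(* Chosen so that [3 * sqrt d = e]. The lowest level [eps] must dominate [E 0] and be positive even
   when [E 0] vanishes. *)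
pose d := (e / 3) ^+ 2.
have d0 : 0 < d by rewrite exprn_gt0// divr_gt0.
pose eps := `|E 0 origin| + d.
have eps0 : 0 < eps by apply: ltr_pwDr.
have B0 : 0 <= B by apply: mean_ge0 => x; exact: sqrtr_ge0.
have sE : sqrt `|E 0 origin| <= B.
  rewrite -[leLHS](mean_cst M); apply: ler_mean => x; apply: ler_wsqrtr.
  by rewrite (dep_E (leq0n M) (y := x))//; exact: martingale_max_ge.
have seps : 3 * sqrt eps <= 3 * B + e.
  have sd : sqrt d = e / 3 by rewrite sqrtr_sqr ger0_norm// divr_ge0 ?(ltW e0).
  have : sqrt eps <= sqrt `|E 0 origin| + sqrt d by apply: sqrtD_le => //; exact: ltW.
  rewrite sd; move: (sqrt eps) (sqrt _) sE => p q; lra.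
pose lam k := eps * 4 ^+ k.
have lam0 k : 0 < lam k by rewrite mulr_gt0// exprn_gt0.
have E0 k x : `|E 0 x| <= lam k.
  rewrite (dep_E (leq0n M) (y := origin))//.
  apply: (@le_trans _ _ eps); first by rewrite lerDl ltW.
  by rewrite ler_peMr ?(ltW eps0)// exprn_ege1// ler1n.
(* All the [E n] share one bound, so a high enough level never stops and the decomposition over
   levels is finite. *)
have [L HL] : exists L, forall x, tau (lam L) x = M.
  have [b Eb] : exists b, forall n x, `|E n x| <= b.
    exists (2 ^+ M * mean M (fun x => `|f x|)) => n x.
    apply: le_trans (ler_norm_aver _ _ _) _.
    set b := leRHS; have <- : aver (index_iota n M) (fun=> b) x = b by rewrite aver_cst.
    apply: ler_aver => {}x; rewrite /b.
    have := @mean_lb R M (fun x => `|f x|) x.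
    rewrite exprVn ler_pdivrMl ?exprn_gt0//; apply => // y z yz.
    by rewrite (fM yz).
  exists (Num.bound (b / eps)) => x; rewrite /tau.
  set L := Num.bound _.
  have bL : b <= lam L.
    have b0 : 0 <= b by apply: le_trans (Eb 0%N x).
    rewrite /lam mulrC -ler_pdivrMr//.
    apply: le_trans (ltW (archi_boundP _)) _; first by rewrite divr_ge0// ltW.
    by rewrite -/L -natrX ler_nat ltnW// ltn_expl.
  apply/eqP; rewrite eqn_leq -{1}[X in (_ <= X)%N](size_iota 0) find_size /=.
  rewrite leqNgt -[X in (_ < X)%N](size_iota 0) -has_find -all_predC.
  apply/allP => n _ /=; rewrite -leNgt ge_max.
  by rewrite !(le_trans (Eb _ _) bL).
have fE : f = fun x => stop (lam 0) x + \sum_(0 <= k < L) \sum_(0 <= N < M)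
    piece (lam k) (4 * lam k) N x.
  apply/funext => x.
  have -> : f x = stop (lam L) x by rewrite /stop HL /E cexp_fix.
  have step k : \sum_(0 <= N < M) piece (lam k) (4 * lam k) N x =
      stop (lam k.+1) x - stop (lam k) x.
    have -> : 4 * lam k = lam k.+1 by rewrite /lam exprS; ring.
    have [tM|tM] := ltnP (tau (lam k) x) M.
      rewrite (bigD1_seq (tau (lam k) x)) ?iota_uniq ?mem_index_iota//=.
      rewrite {1}/piece eqxx mul1r big1 ?addr0// => i.
      by rewrite /piece eq_sym => /negbTE ->; rewrite mul0r.
    have tk : tau (lam k) x = M by apply/eqP; rewrite eqn_leq tau_le.
    have tk1 : tau (lam k.+1) x = M.
      apply/eqP; rewrite eqn_leq tau_le -tk tau_mono//.
      by rewrite /lam exprS mulrCA ler_peMl// ?(ltW (lam0 _))// ler1n.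
    rewrite /stop tk tk1 subrr big_nat big1// => i /andP[_ iM].
    by rewrite /piece tk gtn_eqF// mul0r.
  under eq_bigr do rewrite step.
  by rewrite telescope_sumr// addrC subrK.
rewrite fE; apply: le_trans (mean_sqrt_fejerD _ _ _ _ _) _.
have part1 : mean_sqrt_fejer M K n_ (stop (lam 0)) <= 3 * sqrt eps.
  rewrite -[leRHS](mean_cst M); apply: mean_sqrt_fejer_le => [x|x k].
    by rewrite mulr_ge0 ?sqrtr_ge0.
  have : `|fejer M (stop (lam 0)) (n_ k) x| <= 3 ^+ 2 * eps.
    apply: (@le_trans _ _ (8 * eps)); last by lra.
    apply: norm_fejer_le; first exact: nM.
    by move=> t; have := E_tau (E0 0%N t) (leqnn _); rewrite {2}/lam expr0 mulr1.
  move/ler_wsqrtr/le_trans; apply.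
  by rewrite sqrtrM ?exprn_ge0// sqrtr_sqr ger0_norm.
have part2 : mean_sqrt_fejer M K n_ (fun x => \sum_(0 <= k < L) \sum_(0 <= N < M)
    piece (lam k) (4 * lam k) N x) <= 12 * C * B.
  apply: le_trans (mean_sqrt_fejer_sum _ _ _ _ _ _) _.
  apply: (@le_trans _ _ (\sum_(0 <= k < L) 3 * C * sqrt (lam k) *
      (2 * mean M (fun x => (lam k < martingale_max x)%R%:R : R)))).
    apply: ler_sum => k _; apply: le_trans (mean_sqrt_fejer_sum _ _ _ _ _ _) _.
    apply: (@le_trans _ _ (\sum_(0 <= N < M) 3 * C * sqrt (lam k) *
        mean M (fun x => (tau (lam k) x == N)%:R : R))).
      rewrite big_nat [leRHS]big_nat; apply: ler_sum => N /andP[_ NM].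
      exact: mean_sqrt_fejer_piece.
    by rewrite -mulr_sumr ler_wpM2l ?mean_tau// !mulr_ge0 ?sqrtr_ge0.
  have -> : 12 * C * B = 6 * C * (2 * B) by ring.
  apply: (@le_trans _ _ (6 * C * mean M (fun x => \sum_(0 <= k < L)
      sqrt (lam k) * (lam k < martingale_max x)%R%:R))).
    rewrite mean_sum mulr_sumr le_eqVlt; apply/orP; left; apply/eqP.
    by apply: eq_bigr => k _; rewrite meanZ; ring.
  rewrite ler_wpM2l ?mulr_ge0// -meanZ; apply: ler_mean => x.
  have se : sqrt eps != 0 by rewrite gt_eqF// sqrtr_gt0.
  (* In units of [sqrt eps] the square roots of the levels are the powers [2 ^+ k], as [sum_pow2]
     requires. *)
  have -> : sqrt (martingale_max x) = sqrt eps * (sqrt (martingale_max x) / sqrt eps) by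
      field.
  set y := _ / _.
  have y0 : 0 <= y by rewrite divr_ge0 ?sqrtr_ge0.
  rewrite mulrCA; apply: le_trans (ler_wpM2l (sqrtr_ge0 _) (sum_pow2 L y0)).
  rewrite mulr_sumr; apply: ler_sum => k _.
  have -> : sqrt (lam k) = sqrt eps * 2 ^+ k.
    rewrite /lam sqrtrM ?(ltW eps0)// (_ : 4 = 2 * 2 :> R); last by ring.
    by rewrite exprMn -expr2 sqrtr_sqr ger0_norm// exprn_ge0.
  rewrite -mulrA !ler_wpM2l ?sqrtr_ge0 ?exprn_ge0//.
  case: (ltP (lam k)) => // lk; rewrite (_ : _ < y)//.
  rewrite /y ltr_pdivlMr ?sqrtr_gt0// -[2 ^+ k]ger0_norm ?exprn_ge0//.
  rewrite -sqrtr_sqr -sqrtrM ?exprn_ge0// ltr_sqrt; last exact: lt_trans lk.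
  rewrite -exprM mulnC exprM (_ : 2 ^+ 2 = 4 :> R); last by ring.
  by rewrite mulrC.
lra.
Qed.

End decomposition.
End stopping.

(** * Integration over the dyadic group *)

Section haar_measure.
Context {R : realType}.
Variables (mu : probability walsh_group R) (mu_haar : is_haar mu).

Lemma cylinderE M (u x : G) : cylinder M u x <-> agree M u x.
Proof. by split=> [H|/agreeP//]; apply/agreeP. Qed.

Lemma depE M (f : G -> R) : dep M f ->
  f = fun x => \sum_(0 <= p < 2 ^ M) f (bit p) * \1_(cylinder M (bit p)) x.
Proof.
move=> fM; apply/funext => x; rewrite -[LHS]mulr1 -(sum_agree M x) mulr_sumr.
apply: eq_bigr => p _; rewrite indicE.
have -> : (x \in cylinder M (bit p)) = agree M (bit p) x.
  by apply/idP/idP; rewrite inE => /cylinderE.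
by case: (boolP (agree _ _ _)) => [/agreeP H|]; rewrite ?mulr0//= (fM _ _ H).
Qed.

Lemma dep_indic_cylinder n u : dep n (\1_(cylinder n u) : G -> R).
Proof.
move=> x y xy; rewrite !indicE; congr (_%:R); congr nat_of_bool.
apply/idP/idP; rewrite !inE => H j jM; first by rewrite -xy// H.
by rewrite xy// H.
Qed.

Lemma measurable_dep M (f : walsh_group -> R) : dep M f -> measurable_fun setT f.
Proof.
move=> fM; rewrite (depE fM); apply: measurable_sum => p.
apply: measurable_funM => //; apply: measurable_indic.
exact: measurable_cylinder.
Qed.

Lemma integrable_dep M (f : walsh_group -> R) : dep M f -> mu.-integrable setT (EFin \o f).
Proof.
move=> fM; apply: measurable_bounded_integrable => //.
- by apply: le_lt_trans (probability_le1 mu measurableT) _; rewrite ltry.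
- exact: measurable_dep fM.
exists (2 ^+ M * mean M (fun x => `|f x|)); split; first exact: num_real.
move=> b /ltW Bb x _ /=; apply: le_trans Bb.
have := @mean_lb R M (fun x => `|f x|) x.
rewrite exprVn ler_pdivrMl ?exprn_gt0//; apply => // y z yz.
by rewrite (fM _ _ yz).
Qed.

(** The bridge between Lebesgue integration and the finite averages: after expansion over the
    cylinders of rank [M], both sides give each of them mass [2^-1 ^+ M]. *)
Lemma integral_dep M (f : walsh_group -> R) : dep M f ->
  (\int[mu]_x (f x)%:E = (mean M f)%:E)%E.
Proof.
move=> fM; rewrite {1}(depE fM).
under eq_integral do rewrite -sumEFin.
rewrite integral_sum//=; last first.
  move=> p; apply: (@integrable_dep M) => x y xy; congr (_ * _).
  exact: dep_indic_cylinder xy.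
rewrite (@eq_mean R M _ (fun x => \sum_(0 <= p < 2 ^ M) f (bit p) * (agree M (bit p)
    x)%:R)); last first.
  move=> x; rewrite -[LHS]mulr1 -[in LHS](sum_agree M x) mulr_sumr.
  apply: eq_bigr => p _.
  by case: agreeP => [H|_]; [congr (_ * _); exact: fM|rewrite !mulr0].
rewrite mean_sum -sumEFin; apply: eq_bigr => p _.
rewrite meanZ mean_agree//.
under eq_integral do rewrite EFinM.
rewrite integralZl//; last first.
  by apply: (@integrable_dep M); exact: dep_indic_cylinder.
rewrite integral_indic//; last exact: measurable_cylinder.
rewrite setIT EFinM; congr (_ * _)%E; have /is_haarP H := mu_haar; exact: H.
Qed.

(** The sets that do not separate [x] from [y] form a sigma-algebra containing the cylinders of rank
    [n]. *)
Lemma zeta_agree n (A : set walsh_group) (x y : G) : zeta n A ->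
  (forall j, (j < n)%N -> x j = y j) -> A x <-> A y.
Proof.
move=> zA xy; pose S := [set A : set G | A x <-> A y].
have SA : sigma_algebra setT S.
  split.
  - by split.
  - by move=> B [Bxy Byx]; split=> -[_ nB]; split=> // ?; apply: nB; [apply: Byx|apply:
      Bxy].
  - by move=> B SB; split=> -[i _ Bi]; exists i => //; apply/(SB i).
apply: smallest_sub SA _ A zA => _ [u _ <-].
by split=> H j jn; [rewrite -xy|rewrite xy]; rewrite ?H.
Qed.

Lemma dep_measurable_cylinders n (f : walsh_group -> R) :
  measurable_fun [set: g_sigma_algebraType (cylinders n)] f -> dep n f.
Proof.
move=> mf x y xy.
have : zeta n (f @^-1` [set f x]).
  by have := mf measurableT [set f x] (measurable_set1 _); rewrite setTI.
by move=> zA; have [/(_ erefl)] := zeta_agree zA xy.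
Qed.

Lemma zeta_dep n (A : set walsh_group) : zeta n A -> dep n (\1_A : G -> R).
Proof.
move=> zA x y xy; rewrite !indicE; congr (_%:R); congr nat_of_bool.
have [Axy Ayx] := zeta_agree zA xy.
by apply/idP/idP; rewrite !inE.
Qed.

Lemma measurable_dep_cylinders n (f : G -> R) : dep n f ->
  measurable_fun [set: g_sigma_algebraType (cylinders n)] f.
Proof.
move=> fn; rewrite (depE fn); apply: measurable_sum => p.
apply: measurable_funM => //; apply: measurable_indic.
by apply: sub_gen_smallest; exists (bit p).
Qed.

Lemma integral_in M (f : walsh_group -> R) (A : set walsh_group) :
  dep M f -> dep M (\1_A : G -> R) ->
  (\int[mu]_(x in A) (f x)%:E = (mean M (fun x => f x * \1_A x))%:E)%E.
Proof.
move=> fM AM; rewrite integral_mkcond -integral_dep; last first.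
  by move=> x y xy; rewrite (fM _ _ xy) (AM _ _ xy).
apply: eq_integral => x _; rewrite patchE indicE.
by case: (x \in A); rewrite ?mulr1 ?mulr0.
Qed.

Lemma martingale_dep (F : nat -> walsh_group -> R) n : martingale mu F -> dep n (F n).
Proof. by move=> [mF _ _]; apply: dep_measurable_cylinders. Qed.

(** The martingale identity is tested on the cylinder of rank [n] around [u] and divided by its
    measure. *)
Lemma martingale_cexp (F : nat -> walsh_group -> R) n M : martingale mu F -> (n <= M)%N ->
  F n = cexp n M (F M).
Proof.
move=> mF nM; apply/funext => u.
have Fn k : dep k (F k) by exact: martingale_dep.
have [_ _ /(_ n M (cylinder n u) nM)] := mF.
have zu : zeta n (cylinder n u) by apply: sub_gen_smallest; exists u.
move=> /(_ zu).
have dM := dep_leq nM (@dep_indic_cylinder n u).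
rewrite !(@integral_in M)//; last exact: dep_leq nM (Fn n).
have e f : dep M f -> mean M (fun x => f x * \1_(cylinder n u) x) = 2^-1 ^+ n * cexp n M
    f u.
  move=> fM; rewrite -mean_agreeM//; apply: eq_mean => x.
  rewrite mulrC indicE; congr (_%:R * _); congr nat_of_bool.
  by apply/idP/idP; rewrite inE => /cylinderE.
move=> []; rewrite !e//; last exact: dep_leq nM (Fn n).
rewrite (cexp_fix _ (Fn n)) => /mulfI -> //.
Qed.

(** The integrals are constant from [M] on: [walsh k] depends on the first [M] coordinates, so only
    the conditional expectation [F M] of [F n] enters. *)
Lemma fourier_coefE (F : nat -> walsh_group -> R) k M : martingale mu F -> (k < 2 ^ M)%N ->
  fourier_coef mu F k = mean M (fun x => F M x * walsh k x).
Proof.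
move=> mF kM; rewrite /fourier_coef.
apply: (@lim_near_cst R); first exact: Rhausdorff.
exists M => // n /= Mn.
have kn : (k < 2 ^ n)%N by apply: leq_trans kM _; rewrite leq_exp2l.
rewrite /Rintegral (@integral_dep n); last first.
  by move=> x y xy; rewrite (martingale_dep mF xy) (dep_walsh kn xy).
rewrite /= -(@mean_cexp _ M)//; last first.
  by move=> x y xy; rewrite (martingale_dep mF xy) (dep_walsh kn xy).
rewrite (_ : (fun x => _) = (fun x => walsh k x * F n x)); last first.
  by apply/funext => x; rewrite mulrC.
rewrite cexpM; last exact: dep_walsh.
rewrite -(martingale_cexp mF Mn) (mean_dep Mn).
  by apply: eq_mean => x; rewrite mulrC.
by move=> x y xy; rewrite (martingale_dep mF xy) (dep_walsh kM xy).
Qed.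

Lemma fejer_meanE (F : nat -> walsh_group -> R) n M : martingale mu F -> (n <= 2 ^ M)%N ->
  fejer_mean mu F n = fejer M (F M) n.
Proof.
move=> mF nM; apply/funext => x; rewrite /fejer_mean /fejer /conv; congr (_ * _).
rewrite (@eq_mean _ _ _ (fun t => \sum_(1 <= k < n.+1) \sum_(0 <= i < k)
  walsh i x * (F M t * walsh i t))); last first.
  move=> t; rewrite /fejer_sum mulr_sumr; apply: eq_bigr => k _; rewrite /dirichlet
      mulr_sumr.
  by apply: eq_bigr => i _; rewrite walsh_addg mulrCA.
rewrite mean_sum; apply: eq_big_nat => k /andP[_ kn].
rewrite /partial_sum mean_sum; apply: eq_big_nat => i /andP[_ ik].
rewrite meanZ mulrC; congr (_ * _); apply: fourier_coefE => //.
by apply: leq_trans nM; apply: leq_trans ik _; rewrite -ltnS.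
Qed.

(** Running maxima replace the single terms so that the sequence is nondecreasing and monotone
    convergence can be used next. *)
Lemma poweR_ereal_sup (u : nat -> R) : (forall k, 0 <= u k) ->
  ((`|ereal_sup (range (fun k => (u k)%:E))| `^ 2^-1)%E =
   ereal_sup (range (fun K => (sqrt (\big[Num.max/0]_(k < K) u k))%:E))).
Proof.
move=> u0; set s := ereal_sup _; set w := ereal_sup _.
have s0 : (0 <= s)%E.
  apply: (@le_trans _ _ (u 0%N)%:E); first by rewrite lee_fin.
  by apply: ereal_sup_ubound; exists 0%N.
rewrite gee0_abs//.
have w0 : (0 <= w)%E.
  apply: (@le_trans _ _ (sqrt (\big[Num.max/0]_(k < 0) u k))%:E).
    by rewrite lee_fin sqrtr_ge0.
  by apply: ereal_sup_ubound; exists 0%N.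
have us k : ((u k)%:E <= s)%E by apply: ereal_sup_ubound; exists k.
have uw k : ((sqrt (u k))%:E <= w)%E.
  apply: (@le_trans _ _ (sqrt (\big[Num.max/0]_(k' < k.+1) u k'))%:E).
    rewrite lee_fin ler_wsqrtr//.
    exact: (le_bigmax _ (fun i : 'I_k.+1 => u i) ord_max).
  by apply: ereal_sup_ubound; exists k.+1.
apply/eqP; rewrite eq_le; apply/andP; split; last first.
  apply: ge_ereal_sup => _ [K _ <-].
  case Es : s s0 us => [r| |]// r0 us; last by rewrite /poweR (negbTE (invr_neq0 _)) ?leey.
  rewrite poweR_EFin lee_fin powR12_sqrt//.
  apply: sqrt_bigmax_le; first exact: sqrtr_ge0.
  by move=> i _; rewrite ler_wsqrtr// -lee_fin.
case Ew : w w0 uw => [r| |]// r0 uw; last by rewrite leey.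
rewrite lee_fin in r0.
have sr : (s <= (r ^+ 2)%:E)%E.
  apply: ge_ereal_sup => _ [k _ <-]; rewrite lee_fin.
  have := uw k; rewrite lee_fin => h.
  by rewrite -[leLHS]sqr_sqrtr// lerXn2r ?nnegrE ?sqrtr_ge0.
case Es : s s0 sr => [q| |]// q0.
rewrite lee_fin poweR_EFin lee_fin powR12_sqrt// => /ler_wsqrtr.
by rewrite sqrtr_sqr ger0_norm.
Qed.

Lemma integral_sqrt_sup (u : nat -> walsh_group -> R) (b : nat -> nat) :
  (forall k x, 0 <= u k x) -> (forall K k, (k < K)%N -> dep (b K) (u k)) ->
  (\int[mu]_x (`|ereal_sup (range (fun k => (u k x)%:E))| `^ 2^-1) =
   ereal_sup (range (fun K => (mean (b K)
     (fun x => sqrt (\big[Num.max/0]_(k < K) u k x)))%:E)))%E.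
Proof.
move=> u0 ub.
pose v K x := sqrt (\big[Num.max/0]_(k < K) u k x).
have vb K : dep (b K) (v K).
  move=> x y xy; rewrite /v; congr sqrt; apply: eq_bigr => -[k kK] _ /=.
  exact: (ub K k kK).
have vmono x : {homo (fun K => (v K x)%:E) : n m / (n <= m)%N >-> (n <= m)%E}.
  apply/nondecreasing_seqP => n; rewrite lee_fin ler_wsqrtr//.
  apply: bigmax_le => [|i _]; first exact: bigmax_ge_id.
  exact: (le_bigmax _ (fun i : 'I_n.+1 => u i x) (widen_ord (leqnSn n) i)).
under eq_integral.
  move=> x _; rewrite poweR_ereal_sup//.
  rewrite -(cvg_lim _ (ereal_nondecreasing_cvgn (vmono x)))//.
  over.
rewrite monotone_convergence//.
- under eq_fun do rewrite (integral_dep (vb _)).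
  rewrite (cvg_lim _ (ereal_nondecreasing_cvgn _))//.
  move=> n m nm; rewrite -!(integral_dep (vb _)); apply: ge0_le_integral => //.
  + by move=> x _; rewrite lee_fin sqrtr_ge0.
  + by apply/measurable_EFinP; apply: measurable_dep (vb n).
  + by apply/measurable_EFinP; apply: measurable_dep (vb m).
  + by move=> x _; apply: vmono.
- by move=> n; apply/measurable_EFinP; apply: measurable_dep (vb n).
- by move=> n x _; rewrite lee_fin sqrtr_ge0.
Qed.

End haar_measure.

(** * Blocks of binary digits *)

Lemma sum_bits_lt (c : nat -> bool) m : (\sum_(0 <= k < m) c k * 2 ^ k < 2 ^ m)%N.
Proof.
elim: m => [|m IH]; first by rewrite big_geq.
by rewrite big_nat_recr//= expnS; case: (c m); lia.
Qed.

Lemma bit_sum (c : nat -> bool) m e : bit (\sum_(0 <= k < m) c k * 2 ^ k) e = (e < m)%N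
    && c e.
Proof.
have [em|me] := ltnP e m; last by apply: bit_small (sum_bits_lt c m) me.
elim: m em => // m IH; rewrite ltnS leq_eqVlt big_nat_recr//=.
case cm: (c m); rewrite ?mul1n ?mul0n ?addn0.
  rewrite addnC => /orP[/eqP->|em]; first by rewrite cm; apply: bitDs; exact: sum_bits_lt.
  by rewrite bitDl// IH.
move=> /orP[/eqP->|]; last exact: IH.
by rewrite (bit_small (sum_bits_lt c m)).
Qed.

Lemma sum_bitE n m : (n < 2 ^ m)%N -> n = (\sum_(0 <= k < m) bit n k * 2 ^ k)%N.
Proof.
elim: m n => [|m IH] n nm; first by rewrite big_geq//; lia.
rewrite big_nat_recr//=; have [nl|nl] := ltnP n (2 ^ m).
  by rewrite (bit_small nl)// mul0n addn0 -IH.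
rewrite expnS in nm.
have {1 3}-> : (n = 2 ^ m + (n - 2 ^ m))%N by lia.
rewrite bitDs; last by lia.
rewrite mul1n addnC; congr (_ + _)%N; rewrite {1}(IH (n - 2 ^ m)%N); last by lia.
apply: eq_big_nat => k /andP[_ km]; congr (_ * _)%N; congr nat_of_bool.
by rewrite -(bitDl _ km); congr bit; lia.
Qed.

Section blocks.

Let val (bs : seq (nat * nat)) := (\sum_(b <- bs) \sum_(b.1 <= k < b.2.+1) 2 ^ k)%N.
Let wf (bs : seq (nat * nat)) := all (fun b => b.1 <= b.2)%N bs.
Let apart (b c : nat * nat) := (b.2 + 2 <= c.1)%N.
Let covers e (b : nat * nat) := (b.1 <= e <= b.2)%N.

Lemma apart_path b bs : wf bs -> path apart b bs -> all (apart b) bs.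
Proof.
elim: bs b => //= c bs IH b /andP[c12 wbs] /andP[bc cbs]; rewrite bc /=.
apply: sub_all (IH c wbs cbs) => d; move: bc; rewrite /apart; lia.
Qed.

(** Separated blocks are disjoint, so each position is covered at most once and the block sum is a
    binary expansion. *)
Lemma valE m bs : wf bs -> sorted apart bs -> all (fun b => b.2 < m)%N bs ->
  val bs = (\sum_(0 <= k < m) has (covers k) bs * 2 ^ k)%N.
Proof.
elim: bs => [|b bs IH] /=.
  by move=> _ _ _; rewrite /val big_nil big1// => k _; rewrite mul0n.
move=> /andP[b12 wbs] bbs /andP[bm bsm].
rewrite /val big_cons -/(val bs) IH//; last exact: path_sorted bbs.
have -> : (\sum_(b.1 <= k < b.2.+1) 2 ^ k = \sum_(0 <= k < m) covers k b * 2 ^ k)%N.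
  rewrite [RHS](@big_cat_nat _ _ _ b.1)//=; last by lia.
  rewrite [X in (X + _)%N]big_nat [X in (X + _)%N]big1 ?add0n; last first.
    by move=> i /andP[_ ib]; rewrite /covers leqNgt ib mul0n.
  rewrite [RHS](@big_cat_nat _ _ _ b.2.+1)//=; last by lia.
  rewrite [X in (_ + X)%N]big_nat [X in (_ + X)%N]big1 ?addn0; last first.
    by move=> i /andP[bi _]; rewrite /covers [(i <= _)%N]leqNgt bi andbF mul0n.
  by apply: eq_big_nat => i /andP[bi ib]; rewrite /covers bi -ltnS ib mul1n.
rewrite -big_split /=; apply: eq_bigr => k _; rewrite -mulnDl; congr (_ * _)%N.
have := apart_path wbs bbs; have [kb|//] := boolP (covers k b) => /allP H.
rewrite /= (_ : has _ _ = false)//; apply/negbTE/hasPn => c /H.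
move: kb; rewrite /covers /apart; lia.
Qed.

Lemma bit_decomposition n bs e : block_decomposition n bs -> bit n e = has (covers e) bs.
Proof.
move=> [-> wbs sbs]; pose m := (maxn e (\max_(b <- bs) b.2)).+1.
have := @valE m bs wbs sbs; rewrite /val => ->.
  by rewrite bit_sum ltnS leq_maxl.
apply/allP => b bbs; rewrite ltnS; apply: leq_trans (leq_maxr _ _).
exact: (@leq_bigmax_seq _ bs xpredT (fun b => b.2)).
Qed.

(** Digits are read from the top down: a new one either extends the lowest block found so far or
    opens a block of its own. *)
Lemma decomposition_exists n : exists bs, block_decomposition n bs.
Proof.
have [m nm] : exists m, (n < 2 ^ m)%N by exists n; exact: ltn_expl.
suff H k : (k <= m)%N -> exists bs, [/\ (\sum_(m - k <= i < m) bit n i * 2 ^ i)%N = val bs,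
    wf bs, sorted apart bs & all (fun b => m - k <= b.1)%N bs].
  have [bs [H1 H2 H3 _]] := H m (leqnn m).
  by exists bs; split=> //; rewrite {1}(sum_bitE nm); move: H1; rewrite subnn => ->.
elim: k => [_|k IH km].
  by exists [::]; rewrite subn0 big_geq// /val big_nil.
have [bs [H1 H2 H3 H4]] := IH (ltnW km).
have e : (m - k)%N = (m - k.+1).+1 by lia.
rewrite big_ltn; last by lia.
rewrite -e H1; case: (bit n (m - k.+1)); last first.
  exists bs; split=> //; apply: sub_all H4 => b; lia.
rewrite mul1n; move: e H4; set a := (m - k.+1)%N => -> H4.
have val1 (b : nat * nat) r : val (b :: r) = (\sum_(b.1 <= k < b.2.+1) 2 ^ k + val r)%N.
  by rewrite /val big_cons.
case: bs H1 H2 H3 H4 => [|[l t] r] /= H1 H2 H3 H4.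
  by exists [:: (a, a)]; rewrite val1 /= big_nat1 leqnn; split.
have /andP[lt wr] := H2; have /andP[/= al ar] := H4; simpl in lt.
have [la|la] := eqVneq l a.+1.
  exists ((a, t) :: r); split=> /=.
  - rewrite !val1 /= la addnA; congr (_ + _)%N.
    by rewrite [RHS]big_ltn//; lia.
  - by apply/andP; split=> //=; lia.
  - by case: (r) H3 => //= ? ? /andP[-> ->].
  - by rewrite leqnn /=; apply: sub_all ar => b; lia.
exists ((a, a) :: (l, t) :: r); split=> /=.
- by rewrite [RHS]val1 /= big_nat1.
- by rewrite /wf /= leqnn lt.
- by rewrite H3 andbT /apart /=; lia.
- by rewrite leqnn (ltnW al) /=; apply: sub_all ar => b; lia.
Qed.

Lemma apart_in bs b c : wf bs -> sorted apart bs -> b \in bs -> c \in bs ->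
  [\/ c = b, apart b c | apart c b].
Proof.
elim: bs => // a bs IH /= /andP[_ wbs] abs.
have /allP H := apart_path wbs abs.
rewrite !inE => /orP[/eqP->|bb] /orP[/eqP->|cb].
- by constructor 1.
- by constructor 2; apply: H.
- by constructor 3; apply: H.
- by apply: IH => //; exact: path_sorted abs.
Qed.

(** A local test on digits replaces the quantifier over decompositions. The case [e = 0] stands
    apart because [0.-1] is 0, so the digit tested there would be that of [e] itself. *)
Lemma block_endpointsP n e : block_endpoints n e <->
  bit n e /\ [\/ bit n e.+1 = false, e = 0%N | bit n e.-1 = false].
Proof.
split=> [[bs dbs [[l t] bbs /= eb]]|[ne nend]].
  have [_ wbs sbs] := dbs.
  have lt : (l <= t)%N by exact: (allP wbs _ bbs).
  have out i : (i < l)%N \/ (t < i)%N -> (l <= i.+1)%N -> (i <= t.+1)%N -> bit n i = false.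
    move=> ib b1i ib2; rewrite (bit_decomposition _ dbs).
    apply/negbTE/hasPn => -[c d] cbs; rewrite /covers /=.
    case: (apart_in wbs sbs bbs cbs) => [[-> ->]|bc|cb]; first by lia.
      by move: bc; rewrite /apart /=; lia.
    by move: cb; rewrite /apart /=; lia.
  have ne : bit n e.
    rewrite (bit_decomposition _ dbs); apply/hasP; exists (l, t) => //.
    by rewrite /covers /=; lia.
  split=> //; case: eb => eb.
    case: (posnP e) => [e0|e0]; first by constructor 2.
    by constructor 3; apply: out; lia.
  by constructor 1; apply: out; lia.
have [bs dbs] := decomposition_exists n.
exists bs => //; move: (ne); rewrite (bit_decomposition _ dbs) => /hasP[[l t] bbs be].
exists (l, t) => //.
have nb i : bit n i = false -> ~~ covers i (l, t).
  by rewrite (bit_decomposition _ dbs) => /negbT/hasPn; apply.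
case: nend => [/nb|e0|/nb]; move: be; rewrite /covers /=; lia.
Qed.

End blocks.

Lemma jump_endpoint n j : jump n j -> block_endpoints n j \/ block_endpoints n j.-1.
Proof.
case: j => // j; rewrite /jump /= => jn; case: (boolP (bit n j.+1)) jn => njS; case:
    (boolP (bit n j)) => // nj _.
  by left; apply/block_endpointsP; split=> //; constructor 3; exact: negbTE.
by right; apply/block_endpointsP; split=> //; constructor 1; exact: negbTE.
Qed.

Lemma endpoint_jump n e : block_endpoints n e -> [\/ e = 0%N, jump n e | jump n e.+1].
Proof.
move=> /block_endpointsP[ne [h|->|h]].
- by constructor 3; rewrite /jump /= ne h.
- by constructor 1.
- case: e ne h => [|e] ne h; first by constructor 1.
  by constructor 2; rewrite /jump /= ne -[e]/(e.+1.-1) h.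
Qed.

Lemma jump_le n s j : (n < 2 ^ s)%N -> jump n j -> (j <= s)%N.
Proof.
case: j => // j ns; rewrite /jump /= ltnNge; apply: contra => sj.
by rewrite !(bit_small ns)// ltnW.
Qed.

Section jumps.
Variable n_ : nat -> nat.

Definition jumps (s : nat) : pred nat :=
  fun j => `[< exists2 k, (2 ^ s <= n_ k < 2 ^ s.+1)%N & jump (n_ k) j >].

Definition njumps s := count (jumps s) (index_iota 1 s.+2).

Lemma jumpsP s j : reflect (exists2 k, (2 ^ s <= n_ k < 2 ^ s.+1)%N & jump (n_ k) j)
  (jumps s j).
Proof. exact: asboolP. Qed.

Lemma jumps_bounds s j : jumps s j -> (0 < j < s.+2)%N.
Proof.
move=> /jumpsP[k /andP[_ nk] jj]; rewrite ltnS (jump_le nk jj) andbT.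
by case/andP: jj.
Qed.

Lemma endpoint_set_finite s : finite_set (endpoint_set n_ s).
Proof.
apply: (@sub_finite_set _ _ `I_s.+1); last exact: finite_II.
move=> e [k /andP[_ nk] /block_endpointsP[ne _]] /=.
by rewrite ltnNge; apply/negP => se; rewrite (bit_small nk) in ne.
Qed.

Let ends s : seq nat := fset_set (endpoint_set n_ s).

Let endsP s e : e \in ends s <-> endpoint_set n_ s e.
Proof.
have H : (e \in fset_set (endpoint_set n_ s)) = (e \in endpoint_set n_ s).
  by rewrite in_fset_set//; exact: endpoint_set_finite.
split=> h; first by have : e \in fset_set (endpoint_set n_ s) by []; rewrite H inE.
by change (is_true (e \in fset_set (endpoint_set n_ s))); rewrite H inE.
Qed.

Let countingE (R : realType) s : counting (endpoint_set n_ s) = (size (ends s))%:R%:E :>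
    \bar R.
Proof. by rewrite /counting asboolT//; exact: endpoint_set_finite. Qed.

(** A jump at [j] makes [j] or [j.-1] an endpoint, so the jumps lie in the union of the endpoints
    and their successors. *)
Lemma njumps_le s M : (count (jumps s) (index_iota 1 M) <= 2 * size (ends s))%N.
Proof.
rewrite -size_filter mul2n -addnn -[X in (_ + X)%N](size_map S) -size_cat.
apply: uniq_leq_size; first by rewrite filter_uniq// iota_uniq.
move=> j; rewrite mem_filter mem_cat => /andP[/jumpsP[k nk jj] _].
have j0 : (0 < j)%N by case/andP: jj.
case: (jump_endpoint jj) => h; apply/orP.
  by left; apply/endsP; exists k.
by right; apply/mapP; exists j.-1; rewrite ?prednK//; apply/endsP; exists k.
Qed.

(** Conversely an endpoint is 0, a jump or the predecessor of a jump. Boundedness of the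
    cardinalities is therefore the same for endpoints and for jumps. *)
Lemma ends_le s : (size (ends s) <= 1 + 2 * njumps s)%N.
Proof.
rewrite /njumps -size_filter mul2n -addnn -[X in (1 + (_ + X))%N](size_map predn).
rewrite -size_cat -[X in (_ <= X)%N]/(size (0%N :: _)).
apply: uniq_leq_size; first exact: fset_uniq.
move=> e /endsP[k nk ek]; rewrite inE mem_cat.
have mem j : jump (n_ k) j -> j \in [seq x <- index_iota 1 s.+2 | jumps s x].
  move=> jj; have js : jumps s j by apply/jumpsP; exists k.
  by rewrite mem_filter js mem_index_iota jumps_bounds.
case: (endpoint_jump ek) => [->//|/mem h|/mem h].
  by rewrite h orbT.
by apply/or3P; constructor 3; apply/mapP; exists e.+1.
Qed.

Lemma sup_card_fin (R : realType) : (sup_card_endpoints n_ < +oo :> \bar R)%E ->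
  exists c, forall s M, (count (jumps s) (index_iota 1 M) <= c)%N.
Proof.
move=> sup_fin.
have le s : ((size (ends s))%:R%:E <= (sup_card_endpoints n_ : \bar R))%E.
  by rewrite -countingE; apply: ereal_sup_ubound; exists s.
case E : (sup_card_endpoints n_ : \bar R) sup_fin le => [r| |]// _ le; last first.
  by have := le 0%N.
exists (2 * Num.bound r)%N => s M; apply: leq_trans (njumps_le _ _) _.
rewrite leq_mul2l /= -(ler_nat R); have := le s; rewrite lee_fin => h.
apply: (le_trans h); apply: ltW; apply: archi_boundP; exact: le_trans (ler0n _ _) h.
Qed.

(** Blocks up to [p] have at most [p.+1] jumps each, so unboundedness must come from later ones;
    this permits an increasing choice of ranks. *)
Lemma sup_card_infty (R : realType) : sup_card_endpoints n_ = +oo%E :> \bar R ->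
  forall p K, exists2 s, (p < s)%N & (K <= njumps s)%N.
Proof.
move=> supE p K; apply: contrapT => H.
have : (sup_card_endpoints n_ <= (1 + 2 * (K + p.+2))%:R%:E :> \bar R)%E.
  apply: ge_ereal_sup => _ [s _ <-]; rewrite countingE lee_fin ler_nat.
  apply: leq_trans (ends_le s) _; rewrite leq_add2l leq_mul2l /=.
  have [sp|ps] := leqP s p.
    rewrite /njumps; apply: leq_trans (count_size _ _) _; rewrite size_iota; lia.
  have [Kn|nK] := leqP K (njumps s); first by exfalso; apply: H; exists s.
  by rewrite (leq_trans (ltnW nK))// leq_addr.
by rewrite supE.
Qed.

End jumps.

(** * Boundedness *)

Section bounded.
Context {R : realType}.
Variables (mu : probability walsh_group R) (mu_haar : is_haar mu).
Variables (n_ : nat -> nat) (n_gt0 : forall k, (0 < n_ k)%N).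

Definition rank_bound K := (\sum_(0 <= k < K) n_ k)%N.

Lemma rank_boundP K k : (k < K)%N -> (0 < n_ k < 2 ^ rank_bound K)%N.
Proof.
move=> kK; rewrite n_gt0 /=; apply: leq_ltn_trans (ltn_expl _ (ltnSn 1)).
by rewrite /rank_bound (bigD1_seq k) ?mem_index_iota ?iota_uniq//= leq_addr.
Qed.

Lemma integral_sqrt_restricted (F : nat -> walsh_group -> R) : martingale mu F ->
  (\int[mu]_x (`|restricted_maximal mu n_ F x| `^ 2^-1) =
   ereal_sup (range (fun K => (mean_sqrt_fejer (rank_bound K) K n_ (F (rank_bound
       K)))%:E)))%E.
Proof.
move=> mF; rewrite (integral_sqrt_sup mu_haar (u := fun k x => `|fejer_mean mu F (n_ k) x|)
  (b := rank_bound))//.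
  apply: (congr1 (fun v : nat -> \bar R => ereal_sup (range v))); apply/funext => K;
      congr EFin.
  apply: eq_mean => x; congr Num.sqrt; apply: eq_bigr => -[k kK] _ /=.
  by rewrite (fejer_meanE mu_haar mF (M := rank_bound K))// ltnW//; case/andP:
      (rank_boundP kK).
move=> K k kK x y xy; have /andP[_ /ltnW h] := rank_boundP kK.
by rewrite (fejer_meanE mu_haar mF h) (dep_fejer _ h xy).
Qed.

Lemma integral_sqrt_maximal (F : nat -> walsh_group -> R) : martingale mu F ->
  (\int[mu]_x (`|maximal_function F x| `^ 2^-1) =
   ereal_sup (range (fun K => (mean K
     (fun x => Num.sqrt (\big[Num.max/0]_(k < K) `|F k x|)))%:E)))%E.
Proof.
move=> mF; rewrite (integral_sqrt_sup mu_haar (u := fun k x => `|F k x|) (b := id))//.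
by move=> K k kK x y xy; rewrite (dep_leq (ltnW kK) (martingale_dep mF (n := k)) xy).
Qed.

Lemma restricted_bounded : (sup_card_endpoints n_ < +oo :> \bar R)%E ->
  bounded_hardy_to_lebesgue mu 2^-1 (restricted_maximal mu n_).
Proof.
move=> /sup_card_fin[c Hc].
pose C0 : R := 3 + 12 * (20 * c.+2%:R).
have C00 : 0 <= C0 by rewrite addr_ge0// !mulr_ge0.
(* The quasi-norm is the square of the integral of the square root, so the constant is squared. *)
exists (C0 `^ (2^-1)^-1) => F [mF _].
rewrite /hardy_norm unlock.
set I := (\int[mu]_x (`|maximal_function F x| `^ 2^-1))%E.
have I0 : (0 <= I)%E by apply: integral_ge0 => x _; apply: poweR_ge0.
rewrite -poweR_EFin -poweRM ?lee_fin//.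
apply: gt0_ler_poweR.
- by rewrite invr_ge0.
- by rewrite in_itv /= leey andbT integral_ge0// => x _; apply: poweR_ge0.
- by rewrite in_itv /= leey andbT mule_ge0// lee_fin.
rewrite integral_sqrt_restricted//; apply: ge_ereal_sup => _ [K _ <-].
set M := rank_bound K.
have FM : dep M (F M) := martingale_dep mF (n := M).
have := mean_sqrt_fejer_maximal FM (@rank_boundP K) (T := jumps n_) (c := c).
move=> /(_ _ (fun s => Hc s M.+1)) H.
apply: (@le_trans _ _ (C0 * mean M (fun x => Num.sqrt (martingale_max M (F M) x)))%:E).
  rewrite lee_fin; apply: H => k s kK nk j jj.
  by apply/jumpsP; exists k.
rewrite EFinM lee_wpmul2l ?lee_fin//.
rewrite /I integral_sqrt_maximal//; apply: ereal_sup_ubound; exists M.+1 => //; congr EFin.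
rewrite (mean_dep (leqnSn M)); last first.
  move=> x y xy; congr Num.sqrt; apply: eq_bigr => -[k kM] _ /=.
  by rewrite (dep_leq _ (martingale_dep mF (n := k)) xy)//; exact: kM.
apply: eq_mean => x; congr Num.sqrt; apply: eq_bigr => -[k kM] _ /=.
by rewrite -(martingale_cexp mu_haar mF).
Qed.

End bounded.

(** * Divergence *)

Section lower_bound.
Context {R : realType}.
Implicit Types (x : G).

Lemma walsh_origin n : walsh n origin = 1 :> R.
Proof. by rewrite /walsh big1// => k _; rewrite /rademacher expr0 expr1n. Qed.

Lemma dirichlet_cylinder a k x : (k <= 2 ^ a)%N -> agree a origin x -> dirichlet k x =
    k%:R :> R.
Proof.
move=> ka /agreeP H; rewrite (dep_dirichlet ka H); elim: k {ka} => [|k IH]; first by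
    rewrite dirichlet0.
by rewrite dirichletS IH walsh_origin natr1.
Qed.

Lemma fejer_sum_cylinder a k x : (k <= 2 ^ a)%N -> agree a origin x -> fejer_sum k x =
    k%:R * (k%:R + 1) / 2 :> R.
Proof.
move=> ka ax; elim: k ka => [|k IH] ka; first by rewrite fejer_sum0 mul0r mul0r.
by rewrite fejer_sumS (IH (ltnW ka)) (dirichlet_cylinder ka ax) -natr1; field.
Qed.

(* Used only through its first [a + 2] coordinates, 0, ..., 0, 1, 1. *)
Definition step (a : nat) : G := fun k => (a <= k)%N.

Lemma agree_step a x : agree a.+2 (step a) x = [&& agree a origin x, x a & x a.+1].
Proof.
rewrite !agreeS /step leqnn leqnSn !eqb_id -andbA; congr (_ && _).
by apply/agreeP/agreeP => H j ja; rewrite H// /origin ?[RHS]leqNgt ?[LHS]leqNgt ja.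
Qed.

Lemma small_of_bit a r : (r < 2 ^ a.+1)%N -> bit r a = false -> (r < 2 ^ a)%N.
Proof.
rewrite expnS => r1; apply: contraFT; rewrite -leqNgt => ar.
have -> : r = (2 ^ a + (r - 2 ^ a))%N by lia.
by rewrite bitDs//; lia.
Qed.

(** The digits [x a = x a.+1 = 1] annihilate [fejer_sum (2 ^ S)] for [S >= a.+2] and the Dirichlet
    kernel of [2 ^ S] for [S > a], so binary digits of [m] above [a.+1] contribute only signs. With
    Q = 2^a and r < Q the remainder is Q + r or 2Q + r, giving Q(Q+1)/2 + rQ - r(r+1)/2 or Q^2 -
    r(r+1)/2; both are at least Q^2/2. *)
Lemma norm_fejer_sum_ge a m x : bit m a != bit m a.+1 -> agree a.+2 (step a) x ->
  4 ^+ a / 2 <= `|fejer_sum m x| :> R.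
Proof.
move=> mb; rewrite agree_step => /and3P[ax xa xa1].
have nag S : (a < S)%N -> agree S origin x = false.
  by move=> aS; apply/negbTE/negP => /agreeP/(_ a aS); rewrite xa.
have V1 : fejer_sum (2 ^ a.+1) x = 4 ^+ a :> R.
  by rewrite fejer_sum_pow2S ax /rademacher xa expr1 subrr mul0r add0r mulr1.
have V2z S : (a.+2 <= S)%N -> fejer_sum (2 ^ S) x = 0 :> R.
  move/subnK <-; elim: (S - a.+2)%N => [|d IH].
    by rewrite add0n fejer_sum_pow2S (nag a.+1)// /rademacher xa1 expr1 subrr mul0r mulr0
        addr0.
  by rewrite addSn fejer_sum_pow2S IH nag ?mulr0 ?addr0//; lia.
(* Leading digits beyond [a.+1] are removed one at a time; each only multiplies the sum by a
   Rademacher sign. *)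
have [m' [m'a h2 h3 h4]] : exists m', [/\ (m' < 2 ^ a.+2)%N, bit m' a = bit m a,
    bit m' a.+1 = bit m a.+1 & `|fejer_sum m x| = `|fejer_sum m' x| :> R].
  have [S mS] : exists S, (m < 2 ^ S)%N by exists m; exact: ltn_expl.
  elim: S m mS {mb} => [|S IH] m mS.
    by exists m; split=> //; apply: leq_trans mS _; rewrite leq_exp2l.
  have [Sa|aS] := ltnP S a.+2.
    by exists m; split=> //; apply: leq_trans mS _; rewrite leq_exp2l.
  have [ml|ml] := ltnP m (2 ^ S); first exact: IH.
  have m1S : (m - 2 ^ S < 2 ^ S)%N by move: mS; rewrite expnS; lia.
  have em : m = (2 ^ S + (m - 2 ^ S))%N by lia.
  have [m' [h1 h2 h3 h4]] := IH _ m1S.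
  exists m'; split=> //.
  - by rewrite h2 [in RHS]em bitDl//; lia.
  - by rewrite h3 [in RHS]em bitDl//; lia.
  rewrite em fejer_sumD ?(ltnW m1S)// V2z// dirichlet_pow2 nag ?mulr0 ?add0r; last by lia.
  by rewrite normrM -h4 /rademacher normrX normrN normr1 expr1n mul1r.
move: mb; rewrite -h2 -h3 h4 => mb.
have QQ : 4 ^+ a = 2 ^+ a * 2 ^+ a :> R by rewrite -exprMn; congr (_ ^+ _); ring.
rewrite QQ.
have lemin q : (q < 2 ^ a)%N -> 0 <= q%:R :> R /\ q%:R + 1 <= 2 ^+ a :> R.
  by move=> qa; split=> //; rewrite natr1 -natrX ler_nat.
apply: le_trans (ler_norm _).
have [ml|ml] := ltnP m' (2 ^ a.+1).
  have mb1 := bit_small ml (leqnn _); rewrite mb1 in mb.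
  have am : (2 ^ a <= m')%N.
    by rewrite leqNgt; apply: contra mb => lt; rewrite (bit_small lt (leqnn _)).
  have em : m' = (2 ^ a + (m' - 2 ^ a))%N by lia.
  have ra : (m' - 2 ^ a < 2 ^ a)%N by move: ml; rewrite expnS; lia.
  rewrite em fejer_sumD ?(ltnW ra)// dirichlet_pow2 ax mulr1 !(fejer_sum_cylinder _ ax)
      ?(ltnW ra)//.
  rewrite /rademacher xa expr1 natrX; have [] := lemin _ ra.
  move: (2 ^+ a : R) ((m' - 2 ^ a)%:R : R) => Q r r0 rQ; nra.
have em : m' = (2 ^ a.+1 + (m' - 2 ^ a.+1))%N by lia.
have r1 : (m' - 2 ^ a.+1 < 2 ^ a.+1)%N by move: m'a; rewrite (expnS 2 a.+1); lia.
have mb1 : bit m' a.+1 by rewrite em bitDs.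
have ra : (m' - 2 ^ a.+1 < 2 ^ a)%N.
  apply: small_of_bit r1 _; rewrite -(bitDl _ (ltnSn a)) -em.
  by move: mb; rewrite mb1; case: bit.
rewrite em fejer_sumD ?(ltnW r1)// dirichlet_pow2 nag// V1 (fejer_sum_cylinder _ ax)
    ?(ltnW ra)// QQ.
rewrite /rademacher xa1 expr1; have [] := lemin _ ra.
rewrite /= !mulr0 addr0 mulN1r.
move: (2 ^+ a : R) ((m' - 2 ^ a.+1)%:R : R) => Q r r0 rQ.
have : r * (r + 1) <= Q * Q by apply: ler_pM; lra.
lra.
Qed.

End lower_bound.

(** * Fejer means of a single spike *)

Section atoms.
Context {R : realType}.
Implicit Types (x t : G).

(* [2^s (D_(2^(s+1)) - D_(2^s))], a 1/2-atom. *)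
Definition spike (s : nat) x : R := 4 ^+ s * (rademacher s x * (agree s origin x)%:R).

Lemma dep_spike s : dep s.+1 (spike s).
Proof.
move=> x y xy; rewrite /spike /rademacher xy//.
by rewrite (dep_leq (leqnSn s) (@dep_agree R s origin) xy).
Qed.

Lemma norm_spike s x : `|spike s x| = 4 ^+ s * (agree s origin x)%:R.
Proof.
rewrite /spike !normrM [ `|rademacher s x| ]normrX normrN normr1 expr1n mul1r.
by rewrite !ger0_norm// exprn_ge0.
Qed.

Lemma sqrt_norm_spike s x : Num.sqrt `|spike s x| = 2 ^+ s * (agree s origin x)%:R.
Proof.
rewrite norm_spike (_ : 4 = 2 * 2 :> R); last by ring.
rewrite exprMn -expr2; case: agree; rewrite ?mulr0 ?sqrtr0// !mulr1.
by rewrite sqrtr_sqr ger0_norm// exprn_ge0.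
Qed.

Lemma mean_spikeM M s (h : G -> R) : (s < M)%N -> dep s h ->
  mean M (fun x => spike s x * h x) = 0.
Proof.
move=> sM hs.
rewrite (@eq_mean _ _ _ (fun x => rademacher s x * (4 ^+ s * ((agree s origin x)%:R * h
    x)))).
  by apply: mean_rademacherM => // x y xy; rewrite (hs _ _ xy) (@dep_agree R s origin _ _
      xy).
by move=> x; rewrite /spike; ring.
Qed.

Lemma cexp_spike M s x : (s < M)%N -> cexp s M (spike s) x = 0.
Proof.
move=> sM; apply: (@aver_odd _ _ _ s); first by rewrite mem_index_iota leqnn.
move=> y; rewrite /spike (dep_flip (@dep_agree R s origin))// /rademacher /flip eqxx addbT.
by case: (y s) => /=; rewrite ?expr1 ?expr0; ring.
Qed.

Lemma conv_spike_lt M s n x : (s < M)%N -> (n <= 2 ^ s)%N -> conv M (spike s) n x = 0.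
Proof.
move=> sM ns; apply: (@conv_atom_small _ M s _ (ltnW sM)) => //.
- exact: dep_leq sM (@dep_spike s).
- by move=> y; exact: cexp_spike.
Qed.

(** On the support of the spike, the kernel at [addg x t] differs from the one at [x] only through
    [rademacher s t]. The part free of it averages to zero; in the other its square is 1, leaving
    [4 ^+ s] on a cylinder of measure [2^-1 ^+ s]. *)
Lemma conv_spike M s m x : (s < M)%N -> (m < 2 ^ s)%N ->
  conv M (spike s) (2 ^ s + m) x = 2 ^+ s * (rademacher s x * fejer_sum m x).
Proof.
move=> sM ms; rewrite /conv.
pose c1 : R := fejer_sum (2 ^ s) x + m%:R * dirichlet (2 ^ s) x.
pose c2 : R := 4 ^+ s * (rademacher s x * fejer_sum m x).
rewrite (@eq_mean _ _ _ (fun t => c1 * (spike s t * 1) + c2 * (agree s origin t)%:R)).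
  rewrite meanD !meanZ mean_spikeM// mulr0 add0r mean_agree ?(ltnW sM)// /c2.
  rewrite mulrAC -exprMn; congr (_ ^+ _ * _); lra.
move=> t; rewrite /spike.
have [/agreeP H|_] := boolP (agree s origin t); last by rewrite !(mulr0, mul0r, addr0).
have xt j : (j < s)%N -> addg x t j = x j by move=> js; rewrite /addg H// addbF.
rewrite fejer_sumD ?(ltnW ms)// rademacher_addg (dep_fejer_sum (leqnn _) xt)
    (dep_dirichlet (leqnn _) xt).
rewrite (dep_fejer_sum (ltnW ms) xt) -/c1 /c2 /= !mulr1 mulrDr; congr (_ + _).
  by rewrite mulrC.
rewrite -[in RHS](mul1r (rademacher s x)) -(rademacher_sq s t); ring.
Qed.

End atoms.

Section counterexample.
Context {R : realType}.
Variables (mu : probability walsh_group R) (mu_haar : is_haar mu).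
Variable s_ : nat -> nat.
Hypothesis s_lt : {homo s_ : i j / (i < j)%N >-> (i < j)%N}.

Let s_ge i : (i <= s_ i)%N.
Proof. by elim: i => // i IH; apply: leq_ltn_trans IH (s_lt (ltnSn i)). Qed.

(** Conditional expectation of the formal series of [4^-1 ^+ i * spike (s_ i)]: spikes of rank at
    least [n] average to zero. As [i <= s_ i], the range [i < n] loses no term. *)
Definition lacunary (n : nat) : walsh_group -> R :=
  fun x => \sum_(0 <= i < n | (s_ i < n)%N) 4^-1 ^+ i * spike (s_ i) x.

Lemma lacunaryE n m x : (n <= m)%N ->
  lacunary n x = \sum_(0 <= i < m | (s_ i < n)%N) 4^-1 ^+ i * spike (s_ i) x.
Proof.
move=> nm; rewrite /lacunary [RHS](@big_cat_nat _ _ _ n)//=.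
rewrite [X in _ = _ + X]big_nat_cond [X in _ = _ + X]big1 ?addr0//.
move=> i /andP[/andP[ni _] sn]; exfalso.
by move: (leq_ltn_trans (s_ge i) sn); rewrite ltnNge ni.
Qed.

Lemma dep_lacunary n : dep n (lacunary n).
Proof.
move=> x y xy; apply: eq_bigr => i sn; congr (_ * _).
exact: (dep_leq sn (@dep_spike R (s_ i)) xy).
Qed.

Lemma lacunary_martingale : martingale mu lacunary.
Proof.
split=> [n|n|n m A nm zA].
- apply: measurable_dep_cylinders; exact: dep_lacunary.
- by apply: (@integrable_dep _ _ n); exact: dep_lacunary.
have An := @zeta_dep R n A zA; have Am := dep_leq nm An.
rewrite !(integral_in mu_haar (M := m))//; last 2 first.
- exact: dep_leq nm (@dep_lacunary n).
- exact: dep_lacunary.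
congr EFin.
have E k : (k <= m)%N -> mean m (fun x => lacunary k x * \1_A x) =
    \sum_(0 <= i < m | (s_ i < k)%N) 4^-1 ^+ i * mean m (fun x => spike (s_ i) x * \1_A x).
  move=> km; under eq_bigr do rewrite -meanZ.
  rewrite -mean_sum; apply: eq_mean => x; rewrite (lacunaryE _ km) mulr_suml.
  by apply: eq_bigr => i _; rewrite mulrA.
rewrite !E// [RHS]big_mkcond [LHS]big_mkcond; apply: eq_bigr => i _.
have [sn|ns] := ltnP (s_ i) n; first by rewrite (leq_trans sn nm).
case: ifP => // sm; rewrite mean_spikeM ?mulr0//.
exact: dep_leq ns An.
Qed.

(** Under the square root the coefficients become [2^-1 ^+ i], and each spike contributes mean 1.
    The bound 2 holds for every increasing [s_], which leaves the growth of [s_] free. *)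
Lemma lacunary_hardy : hardy mu 2^-1 lacunary.
Proof.
split; first exact: lacunary_martingale.
rewrite /hardy_norm unlock; apply: poweR_lty.
rewrite (integral_sqrt_maximal mu_haar lacunary_martingale).
apply: (@le_lt_trans _ _ 2%:E); last exact: ltry.
apply: ge_ereal_sup => _ [K _ <-]; rewrite lee_fin.
apply: (@le_trans _ _ (mean K (fun x =>
    \sum_(0 <= i < K | (s_ i < K)%N) 2^-1 ^+ i * (2 ^+ s_ i * (agree (s_ i) origin
        x)%:R)))).
  apply: ler_mean => x.
  have F0 i : 0 <= 2^-1 ^+ i * (2 ^+ s_ i * (agree (s_ i) origin x)%:R) :> R.
    by rewrite !mulr_ge0// exprn_ge0// invr_ge0.
  apply: sqrt_bigmax_le => [|[k kK] _ /=]; first by rewrite sumr_ge0.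
  rewrite (lacunaryE _ (ltnW kK)).
  apply: le_trans (ler_wsqrtr (ler_norm_sum _ _ _)) _.
  apply: le_trans (sqrt_sum_le _ _ _) _ => //.
  rewrite big_mkcond [leRHS]big_mkcond /=; apply: ler_sum => i _.
  have [sk|ks] := ltnP (s_ i) k; last by case: ifP.
  rewrite (ltn_trans sk kK) normrM sqrtrM// sqrt_norm_spike ler_wpM2r//.
  rewrite ger0_norm ?exprn_ge0 ?invr_ge0//.
  rewrite (_ : 4^-1 = 2^-1 ^+ 2 :> R); last by lra.
  by rewrite exprAC sqrtr_sqr ger0_norm// exprn_ge0// invr_ge0.
rewrite mean_sum.
apply: (@le_trans _ _ (\sum_(0 <= i < K) 2^-1 ^+ i)).
  rewrite big_mkcond; apply: ler_sum => i _; case: ifP => sK.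
    rewrite !meanZ mean_agree ?(ltnW sK)// -exprMn divff// expr1n mulr1//.
  by rewrite exprn_ge0// invr_ge0.
suff -> : \sum_(0 <= i < K) 2^-1 ^+ i = 2 - 2 * 2^-1 ^+ K :> R.
  by rewrite gerBl mulr_ge0// exprn_ge0// invr_ge0.
elim: K => [|K IH]; first by rewrite big_geq// expr0; lra.
by rewrite big_nat_recr//= IH exprS; lra.
Qed.

(** Bounds the Fejer means of the earlier spikes through their sup norms, uniformly in the index of
    the mean, hence independently of [s_ i]. *)
Definition debris (i : nat) : R := \sum_(0 <= j < i) 8 * 4 ^+ s_ j.

(** Later spikes are invisible at this index, earlier ones are debris, and the [i]-th is given by
    [conv_spike]; the factor 1/2 comes from [2 ^ s_ i + m <= 2 * 2 ^ s_ i]. *)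
Lemma norm_fejer_lacunary M i m x : (m < 2 ^ s_ i)%N -> (2 ^ s_ i + m < 2 ^ M)%N ->
  4^-1 ^+ i * `|fejer_sum m x| / 2 - debris i <= `|fejer M (lacunary M) (2 ^ s_ i + m) x|.
Proof.
move=> ms nM; set s := s_ i; set n := (2 ^ s + m)%N.
have sM : (s < M)%N by rewrite -(@ltn_exp2l 2)//; apply: leq_ltn_trans nM; rewrite leq_addr.
have iM : (i < M)%N by apply: leq_ltn_trans sM; exact: s_ge.
have n0 : (0 < n)%N by rewrite addn_gt0 expn_gt0.
pose c j : R := 4^-1 ^+ j * conv M (spike (s_ j)) n x.
have cE : conv M (lacunary M) n x = \sum_(0 <= j < M | (s_ j < M)%N) c j.
  by rewrite /lacunary conv_sum; apply: eq_bigr => j _; rewrite /c /conv -meanZ;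
    apply: eq_mean => t; rewrite mulrA.
have c_gt j : (i < j)%N -> (s_ j < M)%N -> c j = 0.
  move=> ij sjM; rewrite /c conv_spike_lt ?mulr0//.
  apply: (@leq_trans (2 ^ s.+1)); first by rewrite expnS mul2n -addnn leq_add2l ltnW.
  by rewrite leq_exp2l// s_lt.
have c_lt j : `|c j| <= n%:R * (8 * 4 ^+ s_ j).
  have i0 : 0 <= 4^-1 ^+ j :> R by rewrite exprn_ge0// invr_ge0.
  have i1 : 4^-1 ^+ j <= 1 :> R by rewrite exprn_ile1//; lra.
  rewrite /c normrM (ger0_norm i0).
  have h : `|conv M (spike (s_ j)) n x| <= 4 ^+ s_ j * (8 * n%:R) :> R.
    apply: norm_conv_le => // t; rewrite norm_spike ler_piMr ?exprn_ge0//.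
    by case: agree.
  apply: (@le_trans _ _ (1 * `|conv M (spike (s_ j)) n x|)); first by rewrite ler_wpM2r.
  by rewrite mul1r; apply: le_trans h _; lra.
have ci : `|c i| = 4^-1 ^+ i * (2 ^+ s * `|fejer_sum m x|).
  rewrite /c conv_spike// !normrM [ `|rademacher _ x| ]normrX normrN normr1 expr1n mul1r.
  by rewrite ger0_norm ?exprn_ge0 ?invr_ge0// (ger0_norm (x := 2 ^+ s)) ?exprn_ge0.
have rest : `|conv M (lacunary M) n x - c i| <= n%:R * debris i.
  rewrite cE big_mkcond (bigD1_seq i) ?iota_uniq ?mem_index_iota//= sM addrAC subrr add0r.
  apply: le_trans (ler_norm_sum _ _ _) _.
  rewrite /debris mulr_sumr (@big_cat_nat _ _ _ i)//=; last exact: ltnW.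
  rewrite -[leRHS]addr0 lerD//.
    have d0 j : 0 <= n%:R * (8 * 4 ^+ s_ j) :> R by rewrite !mulr_ge0// exprn_ge0.
    rewrite big_mkcond; apply: ler_sum => j _; case: ifP => // _.
    by case: ifP => _; rewrite ?normr0.
  rewrite big_nat_cond big1// => j /andP[/andP[ij _] ji].
  case: ifP => sj; rewrite ?normr0// c_gt ?normr0//.
  by rewrite ltn_neqAle eq_sym ji.
have nn0 : 0 < n%:R :> R by rewrite ltr0n.
have n2 : n%:R <= 2 * 2 ^+ s :> R.
  by rewrite -exprS -natrX ler_nat expnS mul2n -addnn leq_add2l ltnW.
rewrite /fejer normrM ger0_norm ?invr_ge0// ler_pdivlMl//.
have h1 : `|c i| - n%:R * debris i <= `|conv M (lacunary M) n x|.
  have := ler_distD (conv M (lacunary M) n x) 0 (c i).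
  by rewrite !sub0r !normrN; lra.
apply: le_trans h1; rewrite mulrBr lerD2r ci.
have p0 : 0 <= 4^-1 ^+ i * `|fejer_sum m x| :> R by rewrite mulr_ge0// exprn_ge0// invr_ge0.
move: p0; rewrite [4^-1 ^+ i * (_ * _)]mulrCA; set p := 4^-1 ^+ i * _ => p0.
have : n%:R * p <= 2 * 2 ^+ s * p by rewrite ler_wpM2r.
lra.
Qed.

End counterexample.

Section divergence.
Context {R : realType}.
Variables (mu : probability walsh_group R) (mu_haar : is_haar mu).
Variables (n_ : nat -> nat) (n_gt0 : forall k, (0 < n_ k)%N).
Variable s_ : nat -> nat.
Hypothesis s_lt : {homo s_ : i j / (i < j)%N >-> (i < j)%N}.

Let prec i := if i is j.+1 then s_ j else 0%N.
(** One jump will contribute [2^-1 ^+ i / 8] to the mean. The prefactor cancels this; of the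
    bracket, the first term pays for the square root of the debris and [i] is left over. *)
Hypothesis many_jumps : forall i,
  (8 * 2 ^ i * (8 * i * 2 ^ prec i + i) <= count (jumps n_ (s_ i)) (index_iota 1 (s_ i)))%N.

Lemma sqrt_debris_le i : Num.sqrt (debris s_ i) <= (8 * i * 2 ^ prec i)%:R :> R.
Proof.
rewrite -[leRHS]ger0_norm// -sqrtr_sqr ler_wsqrtr//.
case: i => [|i]; first by rewrite /debris big_geq// exprn_ge0.
apply: (@le_trans _ _ (\sum_(0 <= j < i.+1) 8 * 4 ^+ s_ i)).
  rewrite /debris big_nat [leRHS]big_nat; apply: ler_sum => j /andP[_ ji].
  rewrite ler_wpM2l// ler_weXn2l ?ler1n//.
  move: ji; rewrite ltnS leq_eqVlt => /orP[/eqP->//|ji]; exact/ltnW/s_lt.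
rewrite sumr_const_nat subn0 /prec.
have -> : 8 * 4 ^+ s_ i = (8 * 4 ^ s_ i)%:R :> R by rewrite natrM natrX.
rewrite -mulrnA -natrX ler_nat.
have -> : (4 ^ s_ i = 2 ^ s_ i * 2 ^ s_ i)%N by rewrite -expnMn.
have : (0 < 2 ^ s_ i)%N by rewrite expn_gt0.
rewrite -mulnn; move: (2 ^ s_ i)%N => q q0; nia.
Qed.

Lemma mean_sqrt_fejer_lacunary i : exists K,
  i%:R <= mean_sqrt_fejer (rank_bound n_ K) K n_ (lacunary s_ (rank_bound n_ K)) :> R.
Proof.
set s := s_ i.
have /choice[kf Hkf] : forall j, exists k, jumps n_ s j ->
    (2 ^ s <= n_ k < 2 ^ s.+1)%N /\ jump (n_ k) j.
  by move=> j; case: (boolP (jumps n_ s j)) => [/jumpsP[k ? ?]|_]; [exists k|exists 0%N].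
(* Large enough to include one witness index for each jump of the block. *)
pose K := (\sum_(0 <= j < s) kf j).+1; exists K; set M := rank_bound n_ K.
have kfK j : (j < s)%N -> (kf j < K)%N.
  move=> js; rewrite ltnS (bigD1_seq j) ?mem_index_iota ?iota_uniq//=.
  by rewrite leq_addr.
have sM j : (j < s)%N -> jumps n_ s j -> (s < M)%N.
  move=> js /Hkf[/andP[sk _] _]; rewrite -(@ltn_exp2l 2)//; apply: leq_ltn_trans sk _.
  by have /andP[] := rank_boundP n_gt0 (kfK _ js).
(* Here [c * 2 ^+ a] is the square root of [4^-1 ^+ i * (4 ^+ a / 2) / 2], the lower bound produced
   by a jump at [a.+1]. *)
pose c : R := 2^-1 ^+ i / 2.
have c0 : 0 <= c by rewrite divr_ge0// exprn_ge0// invr_ge0.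
(* With [j < s] both digits at [j.-1] and [j] lie below the leading digit [s], so they survive its
   removal. *)
pose L x : R := \sum_(1 <= j < s | jumps n_ s j)
  c * 2 ^+ j.-1 * (agree j.+1 (step j.-1) x)%:R.
have mL : mean M L = (count (jumps n_ s) (index_iota 1 s))%:R * (c / 4).
  rewrite /L mean_sum; transitivity (\sum_(1 <= j < s | jumps n_ s j) c / 4); last first.
    by rewrite big_const_seq iter_addr_0 mulr_natl.
  rewrite big_nat_cond [RHS]big_nat_cond; apply: eq_bigr => -[//|a] /andP[/andP[_ js] jj].
  rewrite meanZ mean_agree/=; last exact: leq_trans js (ltnW (sM _ js jj)).
  have : 2 ^+ a * 2^-1 ^+ a = 1 :> R by rewrite -exprMn divff// expr1n.
  rewrite !exprS; move: (2 ^+ a) (2^-1 ^+ a) => p q pq.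
  by transitivity (c / 4 * (p * q)); [field|rewrite pq mulr1].
have Lle x : L x <= Num.sqrt (max_fejer M K n_ (lacunary s_ M) x) + Num.sqrt (debris s_ i).
  have [[j [js jj jx]]|nj] := pselect (exists j, [/\ (0 < j < s)%N, jumps n_ s j &
      agree j.+1 (step j.-1) x]); last first.
    rewrite /L big_nat_cond big1 ?addr_ge0 ?sqrtr_ge0// => j /andP[js jj].
    case: (boolP (agree _ _ _)) => jx; last by rewrite mulr0.
    by case: nj; exists j.
  case: j js jj jx => // a /= js jj jx.
  (* The cylinders are disjoint, since [a] is the position of the first one in [x]; a single term of
     [L] survives. *)
  have -> : L x = c * 2 ^+ a.
    rewrite /L big_mkcond (bigD1_seq a.+1) ?iota_uniq ?mem_index_iota//= jj jx mulr1.
    rewrite big_nat_cond big1 ?addr0// => -[//|b] /andP[_ ba].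
    case: ifP => // _; case: (boolP (agree _ _ _)) => /= bx; last by rewrite mulr0.
    move: jx bx; rewrite !agree_step => /and3P[/agreeP ax xa _] /and3P[/agreeP bx xb _].
    case: (ltngtP a b) ba => [ab _|ba _|->]; last by rewrite eqxx.
      by rewrite bx in xa.
    by rewrite ax in xb.
  have [/andP[sk ks] jk] := Hkf _ jj.
  have kK := kfK _ js; have /andP[_ kM] := rank_boundP n_gt0 kK.
  pose m := (n_ (kf a.+1) - 2 ^ s)%N.
  have em : n_ (kf a.+1) = (2 ^ s + m)%N by rewrite subnKC.
  have ms : (m < 2 ^ s)%N by move: ks; rewrite em expnS; lia.
  have := norm_fejer_lacunary (R := R) s_lt x ms (M := M); rewrite -em => /(_ kM) H.
  have mb : bit m a != bit m a.+1.
    move: jk; rewrite /jump /= em !bitDl//; exact: ltnW.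
  have Vx := norm_fejer_sum_ge (R := R) mb jx.
  have v0 : `|fejer M (lacunary s_ M) (n_ (kf a.+1)) x| <= max_fejer M K n_ (lacunary s_
      M) x :> R.
    exact: (@max_fejer_ge _ M K n_ (lacunary s_ M) x (Ordinal kK)).
  have d0 : 0 <= debris s_ i :> R.
    by apply: sumr_ge0 => j _; rewrite mulr_ge0// exprn_ge0.
  apply: le_trans _ (sqrtD_le (le_trans (normr_ge0 _) v0) d0).
  rewrite -[leLHS]ger0_norm ?mulr_ge0 ?exprn_ge0// -sqrtr_sqr ler_wsqrtr//.
  have -> : (c * 2 ^+ a) ^+ 2 = 4^-1 ^+ i * (4 ^+ a / 2) / 2.
    rewrite /c (_ : 4 = 2 * 2 :> R); last by ring.
    by rewrite invfM !exprMn; field.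
  have : 4^-1 ^+ i * (4 ^+ a / 2) <= 4^-1 ^+ i * `|fejer_sum m x| :> R.
    by rewrite ler_wpM2l// exprn_ge0// invr_ge0.
  lra.
have : mean M L <= mean_sqrt_fejer M K n_ (lacunary s_ M) + Num.sqrt (debris s_ i).
  by rewrite -[X in _ + X](mean_cst M) -meanD; exact: ler_mean.
rewrite mL; have := sqrt_debris_le i.
have := many_jumps i; rewrite -(ler_nat R) -/s natrM.
set N := (count _ _)%:R; set q := (8 * i * 2 ^ prec i)%N.
rewrite natrD natrM natrX => h1 h2 h3.
have h4 : q%:R + i%:R <= N * (c / 4).
  apply: le_trans (ler_wpM2r _ h1); last by rewrite divr_ge0.
  rewrite /c exprVn le_eqVlt; apply/orP; left; apply/eqP; field.
  by rewrite expf_neq0.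
lra.
Qed.

Lemma integral_sqrt_lacunary :
  (\int[mu]_x (`|restricted_maximal mu n_ (lacunary s_) x| `^ 2^-1) = +oo)%E.
Proof.
rewrite (integral_sqrt_restricted mu_haar n_gt0 (lacunary_martingale mu_haar s_lt)).
set v := ereal_sup _.
have le i : (i%:R%:E <= v)%E.
  have [K HK] := mean_sqrt_fejer_lacunary i.
  apply: (@le_trans _ _ (mean_sqrt_fejer (rank_bound n_ K) K n_ (lacunary s_ (rank_bound
      n_ K)))%:E).
    by rewrite lee_fin.
  by apply: ereal_sup_ubound; exists K.
case: v le => [r| |]// le; last by have := le 0%N.
have := le (Num.bound r); rewrite lee_fin leNgt archi_boundP//.
by have := le 0%N; rewrite lee_fin.
Qed.

End divergence.

Lemma restricted_unbounded (R : realType) (mu : probability walsh_group R)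
    (mu_haar : is_haar mu) (n_ : nat -> nat) (n_gt0 : forall k, (0 < n_ k)%N) :
  sup_card_endpoints n_ = +oo%E :> \bar R ->
  exists F, hardy mu 2^-1 F /\
    ('N[mu]_((2^-1)%:E)[restricted_maximal mu n_ F] = +oo)%E.
Proof.
move=> /sup_card_infty H.
pose need i p := (8 * 2 ^ i * (8 * i * 2 ^ p + i))%N.
have /choice[nx Hnx] : forall ip : nat * nat, exists s, (ip.2 < s)%N /\
    (need ip.1 ip.2 <= count (jumps n_ s) (index_iota 1 s))%N.
  (* The extra 2 covers the positions [s] and [s.+1], which [njumps] counts and the range required
     here leaves out. *)
  move=> [i p] /=; have [s ps Hs] := H p (need i p + 2)%N; exists s; split=> //.
  rewrite -(leq_add2r 2); apply: leq_trans Hs _; rewrite /njumps.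
  case: s ps => // s _; rewrite /index_iota !subSS !subn0.
  rewrite -(addn2 s) iotaD count_cat leq_add2l.
  by apply: leq_trans (count_size _ _) _; rewrite size_iota.
pose fix s_ i := if i is j.+1 then nx (j.+1, s_ j) else nx (0%N, 0%N).
have s_lt : {homo s_ : i j / (i < j)%N >-> (i < j)%N}.
  apply: homo_ltn => [i j k|i]; first exact: ltn_trans.
  exact: (Hnx (i.+1, s_ i)).1.
exists (lacunary s_); split; first exact: lacunary_hardy.
rewrite unlock (integral_sqrt_lacunary mu_haar n_gt0 s_lt); last first.
  by case=> [|i]; [exact: (Hnx (0%N, 0%N)).2|exact: (Hnx (i.+1, s_ i)).2].
by rewrite /poweR !invr_eq0 pnatr_eq0.
Qed.

Theorem theorem1 (R : realType) (mu : probability walsh_group R)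
    (mu_haar : is_haar mu) (n_ : nat -> nat) (n_gt0 : forall k, (0 < n_ k)%N) :
  ((sup_card_endpoints n_ < +oo :> \bar R)%E ->
     bounded_hardy_to_lebesgue mu 2^-1 (restricted_maximal mu n_)) /\
  (sup_card_endpoints n_ = +oo%E :> \bar R ->
     (exists F : nat -> walsh_group -> R, hardy mu 2^-1 F /\
        ('N[mu]_((2^-1)%:E)[restricted_maximal mu n_ F] = +oo)%E) /\
     ~ bounded_hardy_to_lebesgue mu 2^-1 (restricted_maximal mu n_)).
Proof.
split=> [|supE]; first exact: restricted_bounded.
have [F [hF TF]] := restricted_unbounded mu_haar n_gt0 supE.
split; first by exists F.
case=> C /(_ F hF); rewrite TF leye_eq => /eqP CF.
have [_ Fy] := hF.
have Ff : hardy_norm mu 2^-1 F \is a fin_num.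
  by rewrite ge0_fin_numE//; exact: Lnorm_ge0.
by have := fin_numM (isT : C%:E \is a fin_num) Ff; rewrite CF.
Qed.
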